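(* Let $n\ge3$ and consider QAOA-MaxCut on the $n$-vertex cycle graph $C_n$. If the (randomly parameterized) circuit $U(\theta)$ is a unitary $2$-design, then the expectation and variance over $\theta$ of the loss function $\ell(\rho,O;\theta)$ are $$\mathbb{E}_\theta[\ell(\rho,O;\theta)]=\frac{\mathrm{parity}(n)}{\sqrt n},\qquad \mathrm{Var}_\theta[\ell(\rho,O;\theta)]=\frac{2(n-\mathrm{parity}(n))}{3n},$$ where $\mathrm{parity}(n)=1$ if $n$ is odd and $0$ if $n$ is even.
   Context: Qubits are indexed by $\mathbb{Z}_n$ (subscripts modulo $n$); $X_j,Z_j$ are Pauli matrices on qubit $j$. The circuit is $U(\theta)=\prod_{l=1}^{p}e^{-i\beta_l\sum_jX_j}e^{-i\gamma_l\sum_jZ_jZ_{j+1}}$ with random real parameters $\theta=(\beta_1,\gamma_1,\dots,\beta_p,\gamma_p)$. The initial state is $\rho=|+\rangle\langle+|^{\otimes n}$, where $|+\rangle=(|0\rangle+|1\rangle)/\sqrt2$; the (normalized) measurement operator is $O=\frac{1}{\sqrt n}\sum_{j\in\mathbb{Z}_n}Z_jZ_{j+1}$; the loss is $\ell(\rho,O;\theta)=\mathrm{tr}(U(\theta)\rho U(\theta)^\dagger O)$. Let $\mathfrak{g}_{C_n}\subseteq\mathfrak{su}(2^n)$ be the real Lie algebra generated by $i\sum_jX_j$ and $i\sum_jZ_jZ_{j+1}$ (bracket $[A,B]=AB-BA$). ''The circuit is a unitary $2$-design'' means that the distribution of $U(\theta)$ agrees up to second moments with the Haar probability measure $\mu$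 on the (closure of the) connected Lie subgroup $e^{\mathfrak{g}_{C_n}}\subseteq SU(2^n)$ with Lie algebra $\mathfrak{g}_{C_n}$: $\mathbb{E}_\theta[U^{\otimes t}\otimes\overline{U}^{\otimes t}]=\int U^{\otimes t}\otimes\overline{U}^{\otimes t}\,d\mu(U)$ for $t=1,2$. *)

(* Defs.v *)
From HB Require Import structures.
From mathcomp Require Import all_boot all_order all_algebra.
From mathcomp Require Import complex mxtens.
From mathcomp Require Import all_classical all_reals all_analysis.

Set Implicit Arguments.
Unset Strict Implicit.
Unset Printing Implicit Defensive.

Import Order.TTheory GRing.Theory Num.Theory.
Import numFieldNormedType.Exports.

Local Open Scope classical_set_scope.
Local Open Scope ring_scope.
Local Open Scope complex_scope.

(* The topology of C is carried by the alias R[i]^o, hence that of complex *)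
(* matrices by 'M[R[i]^o]_N, which is convertible to 'M[R[i]]_N. *)

Section ComplexMatrices.
Context {R : realType}.

Definition mxconj m n (A : 'M[R[i]]_(m, n)) : 'M[R[i]]_(m, n) :=
  map_mx (@conjc R) A.

Definition mxadj m n (A : 'M[R[i]]_(m, n)) : 'M[R[i]]_(n, m) := (mxconj A)^T.

(* exp A = \sum_k A^k / k!, the convergence being that of every entry. *)
Definition expmx N (A : 'M[R[i]]_N) : 'M[R[i]]_N :=
  \matrix_(i, j)
    limn (series (fun k => ((k`!%:R)^-1 * (A ^+ k) i j : R[i]^o))).

(* The real Lie algebra of complex matrices generated by S, for the commutator. *)
Inductive lie_generated N (S : set 'M[R[i]]_N) : set 'M[R[i]]_N :=
| lie_gen A : S A -> lie_generated S A
| lie_zero : lie_generated S 0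
| lie_add A B : lie_generated S A -> lie_generated S B ->
    lie_generated S (A + B)
| lie_scale (a : R) A : lie_generated S A -> lie_generated S (a%:C *: A)
| lie_bracket A B : lie_generated S A -> lie_generated S B ->
    lie_generated S (A *m B - B *m A).

(* The connected Lie subgroup with Lie algebra g is the group generated by the *)
(* exponentials of g; it consists of their finite products, since *)
(* (exp A)^-1 = exp (- A). *)
Definition connected_lie_subgroup N (g : set 'M[R[i]]_N) : set 'M[R[i]]_N :=
  [set U | exists2 s : seq 'M[R[i]]_N,
             (forall A, A \in s -> g A) & U = \prod_(A <- s) expmx A].

Definition mx_closure N (G : set 'M[R[i]]_N) : set 'M[R[i]]_N :=
  closure (G : set 'M[R[i]^o]_N).

Definition borel_mx N := g_sigma_algebraType (@open 'M[R[i]^o]_N).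

(* The Haar probability measure of a closed group G of matrices, viewed as a *)
(* Borel measure on the space of all matrices that is carried by G. *)
Definition is_haar N (G : set 'M[R[i]]_N) (mu : probability (borel_mx N) R) :=
  mu (G : set (borel_mx N)) = 1%E /\
  forall (V : 'M[R[i]]_N) (B : set (borel_mx N)), G V -> measurable B ->
    mu ((fun W : borel_mx N => V *m W : borel_mx N) @^-1` B) = mu B.

Definition cexpectation d (T : measurableType d) (P : probability T R)
    (f : T -> R[i]) : R[i] :=
  (\int[P]_w complex.Re (f w)) +i* (\int[P]_w complex.Im (f w)).

Definition moment_op N (t : nat) (U : 'M[R[i]]_N) :=
  ntensmx U t *t ntensmx (mxconj U) t.

(* The random matrix U agrees with mu up to the k-th moments. *)
Definition unitary_design N (k : nat) (mu : probability (borel_mx N) R)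
    d (T : measurableType d) (P : probability T R) (U : T -> 'M[R[i]]_N) :=
  forall t : nat, (1 <= t <= k)%N -> forall i j,
    cexpectation P (fun w => moment_op t (U w) i j) =
    cexpectation mu (fun V => moment_op t (V : 'M[R[i]]_N) i j).

End ComplexMatrices.

Section CycleQAOA.
Context {R : realType}.

(* The computational basis of n qubits is indexed by the 2 ^ n bit strings *)
(* {ffun 'I_n -> 'I_2}, enumerated by enum_val. *)
Definition dimq (n : nat) : nat := #|{ffun 'I_n -> 'I_2}|.

Definition bits n (x : 'I_(dimq n)) : {ffun 'I_n -> 'I_2} := enum_val x.

Lemma dimqE n : dimq n = (2 ^ n)%N.
Proof. by rewrite /dimq card_ffun !card_ord. Qed.

(* The Kronecker product of the A j, for j < n: its entry at the bit strings *)
(* x and y is \prod_j A j (x j) (y j). *)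
Definition tensq n (A : 'I_n -> 'M[R[i]]_2) : 'M[R[i]]_(dimq n) :=
  \matrix_(x, y) \prod_(j < n) A j (bits x j) (bits y j).

Definition on_qubit n (j : 'I_n) (A : 'M[R[i]]_2) : 'M[R[i]]_(dimq n) :=
  tensq (fun k => if k == j then A else 1%:M).

Definition pauliX : 'M[R[i]]_2 := \matrix_(a, b) (a != b)%:R.
Definition pauliZ : 'M[R[i]]_2 := \matrix_(a, b) ((a == b)%:R * (-1) ^+ a).

Definition X_at n (j : 'I_n) := on_qubit j pauliX.
Definition Z_at n (j : 'I_n) := on_qubit j pauliZ.

(* ordS j is j + 1 modulo n. *)
Definition sumX n : 'M[R[i]]_(dimq n) := \sum_(j < n) X_at j.
Definition sumZZ n : 'M[R[i]]_(dimq n) := \sum_(j < n) Z_at j *m Z_at (ordS j).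

(* The product is ordered, the factor of index 0 being the leftmost. *)
Definition circuit n p (beta gamma : 'I_p -> R) : 'M[R[i]]_(dimq n) :=
  \prod_(l < p) (expmx (- ('i%C * (beta l)%:C) *: sumX n) *m
                 expmx (- ('i%C * (gamma l)%:C) *: sumZZ n)).

Definition ket (a : 'I_2) : 'cV[R[i]]_2 := delta_mx a 0.
Definition ket_plus : 'cV[R[i]]_2 :=
  ((Num.sqrt 2)^-1)%:C *: (ket 0 + ket 1).

Definition rho_plus n : 'M[R[i]]_(dimq n) :=
  tensq (fun _ : 'I_n => ket_plus *m mxadj ket_plus).

Definition obs n : 'M[R[i]]_(dimq n) := ((Num.sqrt n%:R)^-1)%:C *: sumZZ n.

(* The trace is real as soon as rho and O are Hermitian. *)
Definition loss N (rho O U : 'M[R[i]]_N) : R :=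
  complex.Re (\tr (U *m rho *m mxadj U *m O)).

End CycleQAOA.

Definition dla (R : realType) (n : nat) : set 'M[R[i]]_(dimq n) :=
  lie_generated [set A | A = 'i%C *: sumX n \/ A = 'i%C *: sumZZ n].
Arguments dla R n : clear implicits.

Definition dyn_group (R : realType) (n : nat) : set 'M[R[i]]_(dimq n) :=
  mx_closure (connected_lie_subgroup (dla R n)).
Arguments dyn_group R n : clear implicits.

Arguments borel_mx R N : clear implicits.

(* Main.v *)
(* In the even sector [prod X = 1], which contains rho and is preserved by the
   circuit, the Jordan-Wigner transformation turns the generators into the elements
   A_0 = - sum X and A_1 = sum Z Z of the Onsager algebra
     [A_l, A_m] = 4 G_(l-m),   [A_l, G_m] = 2 A_(l-m) - 2 A_(l+m),
   with the antiperiodicity A_(m+n) = - A_m, G_(m+n) = - G_m.  Write <.> for the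
   expectation value in the state U rho U^*.  Left invariance of the Haar measure
   makes E[<.>] and E[<.><.>] invariant under every A_r and G_r, which gives
     E<A_l> = E<A_(l+2)>,
     2 E[<G_m>^2] = E[<A_l><A_(l+2m)>] - E[<A_l>^2].
   The elements Z_l = sum_m A_(l+2m) are central, and sum_m (A_m (x) A_m - G_m (x) G_m)
   is a Casimir element, so <Z_l> and sum_m (<A_m>^2 - <G_m>^2) are constant on the
   group and equal to their values at rho.  These linear relations determine E<A_1>
   and E[<A_1>^2], without diagonalizing the algebra into copies of su(2). *)
Require Import Defs.
From HB Require Import structures.
From mathcomp Require Import all_boot all_order all_algebra.
From mathcomp Require Import ring zify.
From mathcomp Require Import complex mxtens.
From mathcomp Require Import all_classical all_reals all_analysis.
From mathcomp Require Import measurable_realfun.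

Set Implicit Arguments.
Unset Strict Implicit.
Unset Printing Implicit Defensive.

Import Order.TTheory GRing.Theory Num.Theory.
Import numFieldNormedType.Exports.
Local Open Scope ring_scope.

(** * Periodic sums and the Onsager algebra *)

(** The obstacle is that [cycA 1] is not the generator [sumZZ n]: they differ by P - 1 times the
    bond closing the cycle, where P is [parityX]. Two predicates carry the needed facts from the
    generators to brackets. [symmetry] is about elements of the real Lie algebra acting on states of
    the even sector. As this form lives on a finite-dimensional space, it is differentiated through
    matrix entries, never under the integral. The parity of n enters through antiperiodicity: in Z_l
    the indices l + 2m and l + 2m + n cancel for even n, whereas for odd n the value of Z_l at rho
    is n up to sign. First moments are treated as second moments against the identity, so one
    bilinear form serves both formulas. *)

Section PeriodicSums.
Variables (V : zmodType) (n : nat).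
Implicit Types f g : int -> V.

Definition zperiodic f := forall x, f (x + n%:Z) = f x.
Definition zantiperiodic f := forall x, f (x + n%:Z) = - f x.

Lemma psum_shift1 f : zperiodic f ->
  \sum_(j < n) f (j%:Z + 1) = \sum_(j < n) f j.
Proof.
rewrite /zperiodic; case: n => [|m] pf; first by rewrite !big_ord0.
rewrite big_ord_recr big_ord_recl /= addrC; congr (_ + _).
  by rewrite -(pf 0); congr f; lia.
by apply: eq_bigr => j _; congr f; rewrite /bump /=; lia.
Qed.

Lemma psum_shift f (c : int) : zperiodic f ->
  \sum_(j < n) f (j%:Z + c) = \sum_(j < n) f j.
Proof.
move=> pf.
have shiftn (k : nat) (e : int) :
    \sum_(j < n) f (j%:Z + (e + k%:Z)) = \sum_(j < n) f (j%:Z + e).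
  elim: k => [|k IHk]; first by under eq_bigr do rewrite addr0.
  rewrite -IHk -[RHS](@psum_shift1 (fun x => f (x + (e + k%:Z)))).
    by apply: eq_bigr => j _; congr f; lia.
  by move=> x; rewrite -(pf (x + _)); congr f; lia.
have f0 : \sum_(j < n) f j = \sum_(j < n) f (j%:Z + 0).
  by under [RHS]eq_bigr do rewrite addr0.
rewrite f0; case: c => k; first by rewrite -(shiftn k 0) add0r.
by rewrite -(shiftn k.+1); apply: eq_bigr => j _; congr f; lia.
Qed.

(** Reversing the order of summation turns c - j into j + c + 1 minus one period, so a reflection is
    a shift. *)
Lemma psum_reflect f (c : int) : zperiodic f ->
  \sum_(j < n) f (c - j%:Z) = \sum_(j < n) f j.
Proof.
move=> pf; rewrite (reindex_inj rev_ord_inj) -(psum_shift (c + 1) pf).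
apply: eq_bigr => j _; rewrite -(pf (c - _)); congr f.
by have := ltn_ord j; rewrite /=; lia.
Qed.

Lemma antiperiodicB f (x : int) : zantiperiodic f -> f (x - n%:Z) = - f x.
Proof. by move=> af; rewrite -[in RHS](subrK n%:Z x) af opprK. Qed.

Lemma antiperiodic_comp_rev f (c : int) :
  zantiperiodic f -> zantiperiodic (fun x => f (c - x)).
Proof. by move=> af x; rewrite -antiperiodicB //; congr f; lia. Qed.

Lemma antiperiodic_comp_shiftr f (c : int) :
  zantiperiodic f -> zantiperiodic (fun x => f (x + c)).
Proof. by move=> af x; rewrite -af; congr f; lia. Qed.

Lemma antiperiodic2 f x : zantiperiodic f -> f (x + n%:Z *+ 2) = f x.
Proof. by move=> af; rewrite mulr2n addrA !af opprK. Qed.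

(** Euclidean division by [n]. Through this principle, identities indexed by all integers reduce to
    genuine qubit indices. *)
Lemma antiperiodic_ind (P : int -> Prop) :
  (0 < n)%N -> (forall i : nat, (i < n)%N -> P i) ->
  (forall x, P x <-> P (x + n%:Z)) -> forall x, P x.
Proof.
move=> n0 P0 PS x.
have stepn (k : nat) y : P y <-> P (y + n%:Z *+ k).
  elim: k => [|k IHk]; first by rewrite addr0.
  by rewrite mulrS addrCA addrC -PS.
have nN0 : n%:Z != 0 by rewrite -lt0n in n0 *; lia.
have xE : x = (x %% n)%Z + n%:Z * (x %/ n)%Z by rewrite mulrC addrC -divz_eq.
have := modz_ge0 x nN0; have := ltz_mod x nN0; rewrite ger0_norm //.
case: (x %% n)%Z xE => // i xE lt_in _.
have Pi : P i%:Z by apply: P0.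
rewrite xE; case: (x %/ n)%Z => k.
  by have /stepn := Pi; move=> /(_ k); rewrite -mulr_natr natz.
rewrite (stepn k.+1) -mulr_natr natz NegzE mulrN subrK; exact: Pi.
Qed.

End PeriodicSums.

Section PeriodicProducts.
Variables (A : pzRingType) (n : nat).
Implicit Types f g : int -> A.

Lemma antiperiodicM f g :
  zantiperiodic n f -> zantiperiodic n g -> zperiodic n (fun x => f x * g x).
Proof. by move=> af ag x; rewrite af ag mulrNN. Qed.

(* Extends [a] from [0 <= i < n] to all integers with a sign change at each
   period, the boundary condition of the fermions in the sector [prod X = 1]. *)
Definition antiext (a : nat -> A) (x : int) : A :=
  (-1) ^+ `|(x %/ n)%Z| * a `|(x %% n)%Z|%N.

Hypothesis n_gt0 : (0 < n)%N.

Lemma antiext_nat a i : (i < n)%N -> antiext a i = a i.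
Proof.
move=> lt_in; rewrite /antiext divz_nat modz_nat divn_small // modn_small //.
by rewrite expr0 mul1r.
Qed.

Lemma antiext_anti a : zantiperiodic n (antiext a).
Proof.
move=> x; rewrite /antiext modzDr divzDr ?dvdzz // divzz.
have -> : (n%:Z != 0) = true by lia.
rewrite -mulNr; congr (_ * _).
case: (x %/ n)%Z => [k|k].
  by rewrite (_ : absz (k%:Z + 1) = k.+1) ?exprS ?mulN1r //; lia.
rewrite (_ : absz (Negz k + 1) = k); last by lia.
by rewrite /= exprS mulN1r opprK.
Qed.

End PeriodicProducts.

(** * Onsager brackets derived from the Clifford relations *)

Section Onsager.
Variables (A : pzRingType) (n : nat) (u w s : int -> A).
Hypothesis n_gt0 : (0 < n)%N.
Hypothesis u_anti : zantiperiodic n u.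
Hypothesis w_anti : zantiperiodic n w.
Hypothesis s_anti : zantiperiodic n s.
Hypothesis s0 : s 0 = 1.
Hypothesis s_small : forall i : nat, (0 < i < n)%N -> s i = 0.
Hypothesis uu : forall j k, u j * u k + u k * u j = s (j - k) *+ 2.
Hypothesis ww : forall j k, w j * w k + w k * w j = - (s (j - k) *+ 2).
Hypothesis uw : forall j k, u j * w k = - (w k * u j).

(* The Onsager generators A_m and 2 G_m as bilinears in the Majorana operators
   [u j] and [w j], the latter normalized by [w j ^+ 2 = -1]. *)
Definition onsA (m : int) : A := \sum_(j < n) w j%:Z * u (j%:Z + m).
Definition onsG (r : int) : A :=
  \sum_(j < n) (u (j%:Z + r) * u j%:Z + w j%:Z * w (j%:Z - r)).

Definition comm (x y : A) : A := x * y - y * x.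

Lemma commDr x y z : comm x (y + z) = comm x y + comm x z.
Proof. by rewrite /comm mulrDr mulrDl opprD addrACA. Qed.

Lemma comm_suml I r (P : pred I) (F : I -> A) y :
  comm (\sum_(i <- r | P i) F i) y = \sum_(i <- r | P i) comm (F i) y.
Proof. by rewrite /comm mulr_suml mulr_sumr sumrB. Qed.

Lemma comm_sumr I r (P : pred I) (F : I -> A) y :
  comm y (\sum_(i <- r | P i) F i) = \sum_(i <- r | P i) comm y (F i).
Proof. by rewrite /comm mulr_suml mulr_sumr sumrB. Qed.

Lemma commM x y z : comm x (y * z) = comm x y * z + y * comm x z.
Proof. by rewrite /comm mulrBl mulrBr !mulrA addrA subrK. Qed.

Lemma commC x y : comm x y = - comm y x.
Proof. by rewrite /comm opprB. Qed.

(** [s] acts as an antiperiodic Kronecker delta. A product of two antiperiodic functions is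
    periodic, so the sum can be shifted until the support sits at j = 0. *)
Lemma sum_delta_l (f : int -> A) (c : int) : zantiperiodic n f ->
  \sum_(j < n) s (j%:Z - c) * f j%:Z = f c.
Proof.
move=> af.
rewrite -(@psum_shift _ _ (fun x => s (x - c) * f x) c).
  rewrite -(prednK n_gt0) big_ord_recl big1 ?addr0 => [|j _].
    by rewrite !add0r subrr s0 mul1r.
  rewrite addrK s_small ?mul0r // lift0 /=.
  by have := ltn_ord j; lia.
by apply: antiperiodicM af; apply: antiperiodic_comp_shiftr.
Qed.

Lemma sum_delta_r (f : int -> A) (c : int) : zantiperiodic n f ->
  \sum_(j < n) f j%:Z * s (j%:Z - c) = f c.
Proof.
move=> af.
rewrite -(@psum_shift _ _ (fun x => f x * s (x - c)) c).
  rewrite -(prednK n_gt0) big_ord_recl big1 ?addr0 => [|j _].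
    by rewrite !add0r subrr s0 mulr1.
  rewrite addrK s_small ?mulr0 // lift0 /=.
  by have := ltn_ord j; lia.
by apply: antiperiodicM => //; apply: antiperiodic_comp_shiftr.
Qed.

(** A bilinear in Clifford generators acts linearly on the generators: since u' anticommutes with w,
    [w u, u'] = w (u u' + u' u), and the anticommutator selects a single j. *)
Lemma comm_A_u m q : comm (onsA m) (u q) = w (q - m) *+ 2.
Proof.
rewrite comm_suml -(sum_delta_r (q - m) w_anti) -sumrMnl.
apply: eq_bigr => j _; rewrite /comm !mulrA uw mulNr opprK -!mulrA -mulrDr uu.
by rewrite mulrnAr; congr (_ * s _ *+ 2); lia.
Qed.

Lemma comm_A_w m q : comm (onsA m) (w q) = u (q + m) *+ 2.
Proof.
rewrite comm_suml -(@sum_delta_l (fun x => u (x + m)) q); last first.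
  exact: antiperiodic_comp_shiftr.
rewrite -sumrMnl; apply: eq_bigr => j _; rewrite /comm -mulrA uw mulrN !mulrA.
by rewrite -opprD -mulrDl ww mulNr opprK mulrnAl.
Qed.

Lemma onsA_anti : zantiperiodic n onsA.
Proof.
by move=> m; rewrite -sumrN; apply: eq_bigr => j _; rewrite addrA u_anti mulrN.
Qed.

Lemma onsG_anti : zantiperiodic n onsG.
Proof.
move=> m; rewrite -sumrN; apply: eq_bigr => j _.
by rewrite addrA u_anti mulNr opprD addrA antiperiodicB // mulrN -opprD.
Qed.

(** The derivation rule replaces one factor of each pair w u, producing pairs u u and w w; only the
    offset l - m is left after a cyclic shift. *)
Lemma comm_AA l m : comm (onsA l) (onsA m) = onsG (l - m) *+ 2.
Proof.
rewrite comm_sumr.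
under eq_bigr do rewrite commM comm_A_u comm_A_w mulrnAl mulrnAr -mulrnDl.
rewrite sumrMnl; congr (_ *+ 2); rewrite /onsG !big_split /=; congr (_ + _).
  rewrite -(@psum_shift _ _ (fun x => u (x + l) * u (x + m)) (- m)).
    by apply: eq_bigr => j _; congr (u _ * u _); lia.
  by apply: antiperiodicM; apply: antiperiodic_comp_shiftr.
by apply: eq_bigr => j _; congr (_ * w _); lia.
Qed.

(** The derivation rule gives four families of mixed pairs. Two are already in the order w u, with
    offset l - r; the two in the order u w, with offset l + r, acquire a sign when reordered. *)
Lemma comm_AG l r : comm (onsA l) (onsG r) = (onsA (l - r) - onsA (l + r)) *+ 4.
Proof.
rewrite comm_sumr.
under eq_bigr do rewrite commDr !commM !comm_A_u !comm_A_w
  !(mulrnAl, mulrnAr) -!mulrnDl.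
rewrite sumrMnl !big_split /=.
have wu_shift (a b c : int) : b - a = c ->
    \sum_(j < n) w (j%:Z + a) * u (j%:Z + b) = onsA c.
  move=> <-; rewrite /onsA.
  rewrite -(@psum_shift _ _ (fun x => w x * u (x + (b - a))) a).
    by apply: eq_bigr => j _; congr (w _ * u _); lia.
  by apply: antiperiodicM => //; apply: antiperiodic_comp_shiftr.
have E1 : \sum_(j < n) w (j%:Z + r - l) * u j%:Z = onsA (l - r).
  rewrite -(wu_shift (r - l) 0); last by lia.
  by apply: eq_bigr => j _; rewrite addrA addr0.
have E2 : \sum_(j < n) u (j%:Z + r) * w (j%:Z - l) = - onsA (l + r).
  rewrite -(wu_shift (- l) r); last by lia.
  by rewrite -sumrN; apply: eq_bigr => j _; rewrite uw.
have E3 : \sum_(j < n) u (j%:Z + l) * w (j%:Z - r) = - onsA (l + r).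
  rewrite -(wu_shift (- r) l); last by lia.
  by rewrite -sumrN; apply: eq_bigr => j _; rewrite uw.
have E4 : \sum_(j < n) w j%:Z * u (j%:Z - r + l) = onsA (l - r).
  by apply: eq_bigr => j _; congr (_ * u _); lia.
rewrite E1 E2 E3 E4 [- _ + onsA _]addrC -mulr2n -mulrnA.
by [].
Qed.

(** Antisymmetry of [A_r, A_0]. The factor 2 is kept because the ring may have 2-torsion. *)
Lemma onsG_odd2 r : onsG (- r) *+ 2 = - (onsG r *+ 2).
Proof.
by have := commC (onsA r) (onsA 0); rewrite !comm_AA subr0 sub0r => ->; rewrite opprK.
Qed.

End Onsager.

(** * Scalar consequences of the Onsager relations *)

Section OnsagerScalars.
Variables (K : numFieldType) (n : nat).
Hypothesis n_gt0 : (0 < n)%N.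
Implicit Types f g : int -> K.

(** Here [f] and [f'] are the values of the A_m at two states, [g] and [g'] those of the 2 G_m. The
    bracket with A_l exchanges the two families, and the weight 4 on the A part balances the factors
    2 and 4 of the two brackets. *)
Lemma casimir_invariance f g f' g' (l : int) :
  zantiperiodic n f -> zantiperiodic n g -> zantiperiodic n f' ->
  zantiperiodic n g' -> (forall r, g (- r) = - g r) ->
  (forall r, g' (- r) = - g' r) ->
  \sum_(m < n) (4 * (g (l - m%:Z) *+ 2 * f' m + f m * (g' (l - m%:Z) *+ 2))
    - ((f (l - m%:Z) - f (l + m)) *+ 4 * g' m
       + g m * ((f' (l - m%:Z) - f' (l + m)) *+ 4))) = 0.
Proof.
move=> af ag af' ag' og og'.
(* Both halves of the left side equal the same sum: the first by the reflection m to l - m, the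
   second by the shift m to l + m together with the oddness of [k]. *)
have key (h k : int -> K) : zantiperiodic n h -> zantiperiodic n k ->
    (forall r, k (- r) = - k r) ->
    \sum_(m < n) ((h (l - m%:Z) - h (l + m)) * k m) =
    \sum_(m < n) ((h m * k (l - m%:Z)) *+ 2).
  move=> ah ak ok.
  under eq_bigr do rewrite mulrBl.
  rewrite big_split /= sumrN.
  under [RHS]eq_bigr do rewrite mulr2n.
  rewrite [RHS]big_split /=; congr (_ + _).
    rewrite -(@psum_reflect _ _ (fun x => h x * k (l - x)) l).
      by apply: eq_bigr => m _; congr (_ * k _); lia.
    by apply: antiperiodicM => //; apply: antiperiodic_comp_rev.
  rewrite -sumrN -(@psum_shift _ _ (fun x => h x * k (l - x)) l).
    apply: eq_bigr => m _; rewrite -mulrN -ok; congr (h _ * k _); lia.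
  by apply: antiperiodicM => //; apply: antiperiodic_comp_rev.
rewrite sumrB; apply/eqP; rewrite subr_eq0; apply/eqP.
transitivity (4 * \sum_(m < n) (f m * g' (l - m%:Z) *+ 2)
  + 4 * \sum_(m < n) (f' m * g (l - m%:Z) *+ 2)).
  by rewrite -mulrDr -big_split mulr_sumr; apply: eq_bigr => m _ /=; ring.
by rewrite -!key // -mulrDr -big_split mulr_sumr; apply: eq_bigr => m _ /=; ring.
Qed.

(** The indices for m and m + n/2 differ by exactly n, so the terms cancel in pairs. *)
Lemma sum_step2_even f l : zantiperiodic n f -> ~~ odd n ->
  \sum_(m < n) f (l + 2 * m%:Z) = 0.
Proof.
move=> af n_even; have nE : (n = n./2 + n./2)%N by lia.
have -> : \sum_(m < n) f (l + 2 * m%:Z) =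
    \sum_(0 <= m < n./2 + n./2) f (l + 2 * m%:Z) by rewrite -nE big_mkord.
rewrite (@big_cat_nat _ _ _ n./2) ?leq_addr //= -{2}[n./2]add0n big_addn addnK.
rewrite -big_split big1 //= => m _.
rewrite (_ : l + 2 * (m + n./2)%:Z = (l + 2 * m%:Z) + n%:Z) ?af ?addrN //.
lia.
Qed.

Lemma sum_step2_shift f l : zantiperiodic n f ->
  \sum_(m < n) f (l + 2 + 2 * m%:Z) = \sum_(m < n) f (l + 2 * m%:Z).
Proof.
move=> af; rewrite -[RHS](@psum_shift _ _ (fun x => f (l + 2 * x)) 1).
  by apply: eq_bigr => m _; congr f; lia.
move=> x; rewrite -(antiperiodic2 (l + 2 * x) af); congr f; lia.
Qed.

Section SpinValue.
Variable f : int -> K.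
Hypothesis f_anti : zantiperiodic n f.
Hypothesis f0 : f 0 = - n%:R.
Hypothesis f_small : forall i : nat, (0 < i < n)%N -> f i = 0.
Let z l := \sum_(m < n) f (l + 2 * m%:Z).

Let z_step l k : z (l + k%:Z *+ 2) = z l.
Proof.
elim: k => [|k IHk]; first by rewrite addr0.
rewrite -IHk -[RHS](sum_step2_shift _ f_anti) /z.
by apply: eq_bigr => m _; congr f; lia.
Qed.

Let z_anti l : z (l + n%:Z) = - z l.
Proof.
rewrite /z -sumrN; apply: eq_bigr => m _; rewrite -f_anti; congr f; lia.
Qed.

(** For odd n no index 2 m with 0 < m < n is a multiple of n: either it is below n, or it lies
    strictly between n and 2 n. Only m = 0 contributes. *)
Let z0 : odd n -> z 0 = - n%:R.
Proof.
move=> n_odd; rewrite /z; case: n f_anti f0 f_small n_odd => // m af fz fs mo.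
rewrite big_ord_recl addr0 fz big1 ?addr0 // => j _; rewrite lift0 add0r.
have := ltn_ord j => jm.
case: (ltnP (2 * j.+1) m.+1) => [lt2|ge2]; first by rewrite -PoszM fs.
rewrite (_ : 2 * j.+1%:Z = (2 * j.+1 - m.+1)%N%:Z + m.+1%:Z); last by lia.
by rewrite af fs ?oppr0 //; lia.
Qed.

(** For odd n, steps of 2 lead from 1 to n, and z n = - z 0 = n by antiperiodicity. *)
Lemma spin_sum1 : \sum_(m < n) f (1 + 2 * m%:Z) = (n * odd n)%:R.
Proof.
case: (boolP (odd n)) => [n_odd|]; last first.
  by move/(sum_step2_even 1 f_anti) ->; rewrite muln0.
rewrite -/(z 1) -(z_step 1 n./2).
have -> : 1 + n./2%:Z *+ 2 = 0 + n%:Z by lia.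
by rewrite z_anti z0 // opprK muln1.
Qed.

Lemma spin_sum_sqr l : (\sum_(m < n) f (l + 2 * m%:Z)) ^+ 2 = (n ^ 2 * odd n)%:R.
Proof.
case: (boolP (odd n)) => [n_odd|]; last first.
  by move/(sum_step2_even l f_anti) ->; rewrite muln0 expr0n.
rewrite muln1 natrX -/(z l).
suff: z l = z 0 \/ z l = - z 0 by case=> ->; rewrite ?sqrrN z0 // sqrrN.
(* Even indices are reached from 0 by steps of 2; odd ones reach n by such steps, which costs a
   sign. *)
apply: (@antiperiodic_ind n (fun l => z l = z 0 \/ z l = - z 0) n_gt0)
  => [i lt_in|x]; last first.
  rewrite z_anti; split; case=> H; [right; rewrite H|left; rewrite H opprK
    |right; rewrite -H opprK|left; apply: oppr_inj] => //.
case: (boolP (odd i)) => [io|ie].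
  right; rewrite -z_anti (_ : 0 + n%:Z = i%:Z + (n - i)./2%:Z *+ 2) ?z_step //.
  lia.
by left; rewrite (_ : i%:Z = 0 + i./2%:Z *+ 2) ?z_step //; lia.
Qed.

End SpinValue.

(* Here [a], [c] and [e] stand for the moments of the pairs (A, A), (2G, 2G) and
   (A, 1), and [z l] for the value of the central element \sum_m A_(l + 2 m). *)
Lemma onsager_moments (a c : int -> int -> K) (e z : int -> K) :
  (forall r l m, c (r - l) m *+ 2 + (a l (r - m) - a l (r + m)) *+ 4 = 0) ->
  (forall r m, e (r - m) = e (r + m)) ->
  (forall l, \sum_(m < n) e (l + 2 * m%:Z) = z l) ->
  (forall l, \sum_(m < n) a l (l + 2 * m%:Z) = z l * e l) ->
  4 * \sum_(m < n) a m m - \sum_(m < n) c m m = 4 * n%:R ^+ 2 ->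
  z 1 = (n * odd n)%:R -> (forall l, z l ^+ 2 = (n ^ 2 * odd n)%:R) ->
  e 1 = (odd n)%:R /\ a 1 1 = (2 * n + odd n)%:R / 3.
Proof.
move=> Hac He Hz Haz Hcas z1 z2.
have nN0 : n%:R != 0 :> K by rewrite pnatr_eq0 -lt0n.
(* [He] at r = l + m makes all n terms of the sum [Hz] equal to e l. *)
have e_z l : e l = z l / n%:R.
  rewrite -Hz (eq_bigr (fun=> e l)) => [|m _].
    by rewrite sumr_const card_ord -[e l *+ n]mulr_natr mulfK.
  by rewrite -[in RHS](addrK m%:Z l) He; congr e; lia.
have e1 : e 1 = (odd n)%:R by rewrite e_z z1 natrM mulrC mulKf.
(* The choice r = l + m in [Hac] makes the first index of [c] equal to m and turns r - m into l. *)
have c_a l m : c m m = (a l (l + 2 * m) - a l l) *+ 2.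
  have := Hac (l + m) l m.
  have -> : l + m - l = m by lia.
  have -> : l + m - m = l by lia.
  have -> : l + m + m = l + 2 * m by lia.
  move=> H; apply/eqP; rewrite -subr_eq0; apply/eqP.
  by apply: (@mulfI _ 2); rewrite ?pnatr_eq0 // mulr0 -H; ring.
split=> //.
have sum_c l : \sum_(m < n) c m m = ((n * odd n)%:R - n%:R * a l l) *+ 2.
  under eq_bigr do rewrite (c_a l).
  rewrite sumrMnl sumrB Haz sumr_const card_ord e_z mulr_natl; congr ((_ - _) *+ 2).
  by rewrite mulrA -expr2 z2 !natrM; field.
(* The sum of the c m m does not mention l, whereas [sum_c] expresses it through a l l. *)
have a_const l : a l l = a 1 1.
  have := sum_c l; rewrite (sum_c 1) => /eqP.
  by rewrite eqr_pMn2r // => /eqP /addrI /oppr_inj /(mulfI nN0) ->.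
(* The Casimir equation is now 6 n a = 4 n^2 + 2 n odd(n) in the single unknown a = a 1 1; this is
   the origin of the denominator 3. *)
move: Hcas; rewrite (sum_c 1) (eq_bigr (fun=> a 1 1)) => [|m _ //].
rewrite sumr_const card_ord -[a 1 1 *+ n]mulr_natl !(natrM, natrD) => Hcas.
have three : 3 != 0 :> K by rewrite pnatr_eq0.
apply: (mulfI three); apply: (mulfI nN0); apply: (@mulfI _ 2); rewrite ?pnatr_eq0 //.
rewrite [_ / 3]mulrC (mulVKf three) //.
transitivity (4 * n%:R ^+ 2 + 2 * (n%:R * (odd n)%:R) : K); last by ring.
by rewrite -Hcas; ring.
Qed.

End OnsagerScalars.

(** * Pauli strings and the Jordan-Wigner transformation *)

Section PauliStrings.
Variables (R : realType) (n : nat).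
Local Notation C := R[i].
Implicit Types (A B : 'I_n -> 'M[C]_2).

Lemma sum_bits (V : zmodType) (F : {ffun 'I_n -> 'I_2} -> V) :
  \sum_(z < dimq n) F (bits z) = \sum_z F z.
Proof.
by symmetry; apply: (reindex (@bits n)); exists enum_rank => z _;
  [exact: enum_valK|exact: enum_rankK].
Qed.

(** Distributivity: a sum over intermediate bit strings of a product over qubits is a product of
    sums over single bits. *)
Lemma tensqM A B : tensq A *m tensq B = tensq (fun j => A j *m B j).
Proof.
apply/matrixP => x y; rewrite !mxE.
under eq_bigr do rewrite !mxE -big_split /=.
rewrite (sum_bits (fun z => \prod_j (A j (bits x j) (z j) * B j (z j) (bits y j)))).
rewrite -(bigA_distr_bigA (fun j k => A j (bits x j) k * B j k (bits y j))).
by apply: eq_bigr => j _; rewrite mxE.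
Qed.

Lemma mxtrace_tensq A : \tr (tensq A) = \prod_j \tr (A j).
Proof.
transitivity (\sum_x \prod_j A j (bits x j) (bits x j)).
  by apply: eq_bigr => x _; rewrite mxE.
rewrite (sum_bits (fun z => \prod_j A j (z j) (z j))).
by rewrite -(bigA_distr_bigA (fun j k => A j k k)).
Qed.

Lemma eq_tensq A B : A =1 B -> tensq A = tensq B.
Proof. by move=> AB; apply/matrixP => x y; rewrite !mxE; apply: eq_bigr => j _; rewrite AB. Qed.

Lemma tensq1 : tensq (fun _ : 'I_n => 1%:M) = 1%:M :> 'M[C]_(dimq n).
Proof.
apply/matrixP => x y; rewrite !mxE; case: eqVneq => [->|xy].
  by rewrite big1 // => j _; rewrite mxE eqxx.
have : [exists j, bits x j != bits y j].
  rewrite -negb_forall; apply: contra xy => /forallP xy.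
  by apply/eqP/enum_val_inj/ffunP => j; apply/eqP/xy.
by case/existsP => j /negbTE xyj; rewrite (bigD1 j) //= mxE xyj mul0r.
Qed.

Lemma tensq_opp1 A B (m : 'I_n) : A m = - B m -> (forall k, k != m -> A k = B k) ->
  tensq A = - tensq B.
Proof.
move=> Am AB; apply/matrixP => x y; rewrite !mxE (bigD1 m) //= [in RHS](bigD1 m) //=.
rewrite Am mxE mulNr; congr (- (_ * _)); apply: eq_bigr => k km.
by rewrite AB.
Qed.

Lemma mxadj_tensq A : mxadj (tensq A) = tensq (fun j => mxadj (A j)).
Proof.
apply/matrixP => x y; rewrite !mxE rmorph_prod /=.
by apply: eq_bigr => j _; rewrite !mxE.
Qed.

(** Used for Pauli strings: the sign comes from the one site [m] where the letters clash. *)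
Lemma tensq_anticomm A B (m : 'I_n) : A m *m B m = - (B m *m A m) ->
  (forall k, k != m -> A k *m B k = B k *m A k) ->
  tensq A *m tensq B = - (tensq B *m tensq A).
Proof. by move=> Em Ek; rewrite !tensqM; apply: tensq_opp1 Em _. Qed.

Local Notation X := (pauliX : 'M[C]_2).
Local Notation Z := (pauliZ : 'M[C]_2).

Let ord2P (P : 'I_2 -> Prop) : P 0 -> P 1 -> forall i, P i.
Proof.
move=> P0 P1; case=> -[|[|//]] Hi.
  by rewrite (_ : Ordinal Hi = 0) //; apply: val_inj.
by rewrite (_ : Ordinal Hi = 1) //; apply: val_inj.
Qed.

Let mx2P (A B : 'M[C]_2) : A 0 0 = B 0 0 -> A 0 1 = B 0 1 -> A 1 0 = B 1 0 ->
  A 1 1 = B 1 1 -> A = B.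
Proof.
by move=> *; apply/matrixP => i j; move: i j; apply: ord2P; apply: ord2P.
Qed.

Lemma pauliXX : X *m X = 1%:M.
Proof.
by apply: mx2P; rewrite !mxE !big_ord_recr big_ord0 /= !mxE /=; ring.
Qed.

Lemma pauliZZ : Z *m Z = 1%:M.
Proof.
by apply: mx2P; rewrite !mxE !big_ord_recr big_ord0 /= !mxE /=; ring.
Qed.

Lemma pauliXZ : X *m Z = - (Z *m X).
Proof.
by apply: mx2P; rewrite !mxE !big_ord_recr !big_ord0 /= !mxE /=; ring.
Qed.

Lemma mxadj_pauliX : mxadj X = X.
Proof. by apply/matrixP => i j; rewrite !mxE rmorph_nat eq_sym. Qed.

Lemma mxadj_pauliZ : mxadj Z = Z.
Proof.
apply/matrixP => i j; rewrite !mxE rmorphM rmorph_nat rmorphXn rmorphN1 eq_sym.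
by case: eqVneq => [->//|_]; rewrite !mul0r.
Qed.

End PauliStrings.

Lemma antiperiodic_ext2 (V : zmodType) (n : nat) (f g : int -> int -> V) :
  (0 < n)%N ->
  (forall y, zantiperiodic n (f ^~ y)) -> (forall x, zantiperiodic n (f x)) ->
  (forall y, zantiperiodic n (g ^~ y)) -> (forall x, zantiperiodic n (g x)) ->
  (forall i j : nat, (i < n)%N -> (j < n)%N -> f i j = g i j) ->
  forall x y, f x y = g x y.
Proof.
move=> n0 f1 f2 g1 g2 fg x y.
have step (h h' : int -> V) (z : int) : zantiperiodic n h -> zantiperiodic n h' ->
    h z = h' z <-> h (z + n%:Z) = h' (z + n%:Z).
  by move=> ah ah'; rewrite ah ah'; split=> [->//|/oppr_inj].
apply: (antiperiodic_ind (P := fun z => f z y = g z y) n0) => [i lt_in|z].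
  apply: (antiperiodic_ind (P := fun z => f i z = g i z) n0) => [j|z].
    exact: fg.
  exact: step.
exact: (step (f ^~ y) (g ^~ y)).
Qed.

(** * Jordan-Wigner strings on the qubits *)

Section JordanWigner.
Variables (R : realType) (n : nat).
Local Notation C := R[i].
Local Notation X := (pauliX : 'M[C]_2).
Local Notation Z := (pauliZ : 'M[C]_2).
Local Notation M := 'M[C]_(dimq n).

(** Indexing by [nat] allows i.+1 and n.-1 without casts; for i >= n the string is the identity. *)
Definition xq (i : nat) : M :=
  tensq (fun k : 'I_n => if k == i :> nat then X else 1%:M).
Definition zq (i : nat) : M :=
  tensq (fun k : 'I_n => if k == i :> nat then Z else 1%:M).
(** The two Majorana operators of site i, with a tail of X letters, so that fermion parity is the
    product of all X. The last letter of [jww] is Z X = i Y, which keeps i out of the formulas at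
    the price of a square equal to -1. *)
Definition jwu (i : nat) : M :=
  tensq (fun k : 'I_n =>
    if (k < i)%N then X else if k == i :> nat then Z else 1%:M).
Definition jww (i : nat) : M :=
  tensq (fun k : 'I_n =>
    if (k < i)%N then X else if k == i :> nat then Z *m X else 1%:M).
Definition parityX : M := tensq (fun=> X).

Ltac letters := rewrite ?mulmx1 ?mul1mx ?mulmxA ?pauliXZ ?mulNmx ?mulmxN ?opprK;
  rewrite -?mulmxA ?pauliXX ?pauliZZ ?mulmx1 ?mul1mx.

Lemma jwu_sqr i : jwu i *m jwu i = 1%:M.
Proof.
rewrite tensqM -tensq1; apply: eq_tensq => k; case: ltngtP => _; letters => //.
Qed.

Lemma jww_sqr i : (i < n)%N -> jww i *m jww i = - 1%:M.
Proof.
move=> lt_in; rewrite tensqM -tensq1; apply: (tensq_opp1 (m := Ordinal lt_in)).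
  rewrite /= ltnn eqxx mulmxA -(mulmxA Z) pauliXZ mulmxN mulmxA pauliZZ.
  by rewrite mul1mx mulNmx pauliXX.
move=> k; rewrite -val_eqE /= => /negbTE ->; case: ltnP => _; letters => //.
Qed.

(** The only clash is at site i, where the Z ending one string meets the X tail of the other. *)
Lemma jwuu i k : (i < k)%N -> (i < n)%N -> jwu i *m jwu k = - (jwu k *m jwu i).
Proof.
move=> lt_ik lt_in; apply: (tensq_anticomm (m := Ordinal lt_in)) => /=.
  by rewrite ltnn eqxx lt_ik pauliXZ opprK.
move=> j; rewrite -val_eqE /= => /negbTE ->.
by case: ltnP => ji; case: ltngtP => jk; rewrite ?mulmx1 ?mul1mx //; lia.
Qed.

Lemma jwww i k : (i < k)%N -> (i < n)%N -> jww i *m jww k = - (jww k *m jww i).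
Proof.
move=> lt_ik lt_in; apply: (tensq_anticomm (m := Ordinal lt_in)) => /=.
  by rewrite ltnn eqxx lt_ik mulmxA pauliXZ mulNmx opprK.
move=> j; rewrite -val_eqE /= => /negbTE ->.
by case: ltnP => ji; case: ltngtP => jk; rewrite ?mulmx1 ?mul1mx //; lia.
Qed.

Lemma jwuw i k : (i < n)%N -> (k < n)%N -> jwu i *m jww k = - (jww k *m jwu i).
Proof.
move=> lt_in lt_kn; case: (ltngtP i k) => ik.
- apply: (tensq_anticomm (m := Ordinal lt_in)) => /=.
    by rewrite ltnn eqxx ik pauliXZ opprK.
  move=> j; rewrite -val_eqE /= => /negbTE ->.
  by case: ltnP => ji; case: ltngtP => jk; rewrite ?mulmx1 ?mul1mx //; lia.
- apply: (tensq_anticomm (m := Ordinal lt_kn)) => /=.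
    by rewrite ltnn eqxx ik mulmxA pauliXZ mulNmx.
  move=> j; rewrite -val_eqE /= => /negbTE ->.
  by case: ltnP => ji; case: ltngtP => jk; rewrite ?mulmx1 ?mul1mx //; lia.
- rewrite ik; apply: (tensq_anticomm (m := Ordinal lt_kn)) => /=.
    by rewrite ltnn eqxx -[Z *m X *m Z]mulmxA pauliXZ mulmxN opprK.
  move=> j; rewrite -val_eqE /= => /negbTE ->.
  by case: ltnP => ji; rewrite ?mulmx1 ?mul1mx.
Qed.

Lemma parityX_sqr : parityX *m parityX = 1%:M.
Proof. by rewrite tensqM -tensq1; apply: eq_tensq => k; rewrite pauliXX. Qed.

Lemma parityX_jwu i : (i < n)%N -> parityX *m jwu i = - (jwu i *m parityX).
Proof.
move=> lt_in; apply: (tensq_anticomm (m := Ordinal lt_in)) => /=.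
  by rewrite ltnn eqxx pauliXZ.
move=> j; rewrite -val_eqE /= => /negbTE ->.
by case: ltnP => ji; rewrite ?mulmx1 ?mul1mx.
Qed.

Lemma parityX_jww i : (i < n)%N -> parityX *m jww i = - (jww i *m parityX).
Proof.
move=> lt_in; apply: (tensq_anticomm (m := Ordinal lt_in)) => /=.
  by rewrite ltnn eqxx mulmxA pauliXZ mulNmx.
move=> j; rewrite -val_eqE /= => /negbTE ->.
by case: ltnP => ji; rewrite ?mulmx1 ?mul1mx.
Qed.

Lemma xqE i : (i < n)%N -> xq i = - (jww i *m jwu i).
Proof.
move=> lt_in; rewrite tensqM; apply: (tensq_opp1 (m := Ordinal lt_in)) => /=.
  by rewrite ltnn eqxx -mulmxA pauliXZ mulmxN mulmxA pauliZZ mul1mx opprK.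
move=> j; rewrite -val_eqE /= => /negbTE ->.
by case: ltnP => ji; rewrite ?mulmx1 ?pauliXX.
Qed.

(** The X tails cancel below i, and at site i the extra X of [jww] absorbs that of the longer
    tail. *)
Lemma zqzq i : (i.+1 < n)%N -> zq i *m zq i.+1 = jww i *m jwu i.+1.
Proof.
move=> lt_in; rewrite !tensqM; apply: eq_tensq => k.
by case: (ltngtP k i) => ki; case: (ltngtP k i.+1) => ki1;
  rewrite ?mulmx1 ?mul1mx ?pauliXX -?mulmxA ?pauliXX ?mulmx1 //; lia.
Qed.

(** On the closing bond the tail runs through the whole chain, and P removes it up to the sign of X
    Z X = - Z at the last site. Where P = 1, this sign is what the convention u_n = - u_0
    absorbs. *)
Lemma zqzq_last : (1 < n)%N ->
  zq n.-1 *m zq 0 = - (parityX *m (jww n.-1 *m jwu 0)).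
Proof.
move=> n1; have last_lt : (n.-1 < n)%N by lia.
rewrite !tensqM; apply: (tensq_opp1 (m := Ordinal last_lt)) => /=.
  have -> : (n.-1 == 0)%N = false by lia.
  by rewrite ltnn eqxx !mulmx1 mulmxA pauliXZ mulNmx opprK -mulmxA pauliXX mulmx1.
move=> k; rewrite -val_eqE /= => kn; rewrite (negbTE kn) mul1mx.
have -> : (k < n.-1)%N by have := ltn_ord k; lia.
by rewrite mulmxA pauliXX mul1mx.
Qed.
End JordanWigner.

Lemma sum_ord_last (V : zmodType) (n : nat) (F : nat -> V) : (0 < n)%N ->
  \sum_(j < n) F j = \sum_(j < n.-1) F j + F n.-1.
Proof. by case: n => // m _; rewrite big_ord_recr. Qed.

Lemma anticommM (A : pzRingType) (p a b : A) :
  p * a = - (a * p) -> p * b = - (b * p) -> p * (a * b) = a * b * p.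
Proof. by move=> pa pb; rewrite mulrA pa mulNr -!mulrA pb mulrN opprK. Qed.

(** * Cyclic Majorana operators and their values at the initial state *)

Section CycleOnsager.
Variables (R : realType) (n : nat).
Hypothesis n_gt1 : (1 < n)%N.
Local Notation C := R[i].
Local Notation M := 'M[C]_(dimq n).

Let n_gt0 : (0 < n)%N. Proof. exact: ltnW. Qed.

(** The antiperiodic Kronecker delta: supported on the multiples of n, with alternating signs. *)
Definition tdelta (x : int) : C := antiext n (fun i => (i == 0%N)%:R) x.
Definition fermU : int -> M := antiext n (@jwu R n).
Definition fermW : int -> M := antiext n (@jww R n).
Definition smx (x : int) : M := (tdelta x)%:M.
Definition cycA : int -> M := onsA n fermU fermW.
Definition cycG : int -> M := onsG n fermU fermW.

Lemma tdelta_anti : zantiperiodic n tdelta. Proof. exact: antiext_anti. Qed.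
Lemma fermU_anti : zantiperiodic n fermU. Proof. exact: antiext_anti. Qed.
Lemma fermW_anti : zantiperiodic n fermW. Proof. exact: antiext_anti. Qed.
Lemma smx_anti : zantiperiodic n smx.
Proof. by move=> x; rewrite /smx tdelta_anti raddfN. Qed.

Lemma tdelta0 : tdelta 0 = 1. Proof. exact: antiext_nat. Qed.
Lemma tdelta_small i : (0 < i < n)%N -> tdelta i%:Z = 0.
Proof. by case/andP=> i0 lt_in; rewrite /tdelta antiext_nat // (gtn_eqF i0). Qed.

Lemma tdeltaB i j : (i < n)%N -> (j < n)%N -> tdelta (i%:Z - j%:Z) = (i == j)%:R.
Proof.
move=> lt_in lt_jn; case: (ltngtP i j) => [ij|ji|->]; last by rewrite subrr tdelta0.
  rewrite -[LHS]opprK -tdelta_anti.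
  rewrite (_ : _ + _ = (n + i - j)%N%:Z); last by lia.
  by rewrite tdelta_small ?oppr0 //; lia.
by rewrite (_ : _ - _ = (i - j)%N%:Z) ?tdelta_small //; lia.
Qed.

Let antiML (V : pzRingType) (f : int -> V) c :
  zantiperiodic n f -> zantiperiodic n (fun x => f x * c).
Proof. by move=> af x; rewrite af mulNr. Qed.

Let antiMR (V : pzRingType) (f : int -> V) c :
  zantiperiodic n f -> zantiperiodic n (fun x => c * f x).
Proof. by move=> af x; rewrite af mulrN. Qed.

Let antiN (V : zmodType) (f : int -> V) :
  zantiperiodic n f -> zantiperiodic n (fun x => - f x).
Proof. by move=> af x; rewrite af. Qed.

Let antiMn (V : zmodType) (f : int -> V) k :
  zantiperiodic n f -> zantiperiodic n (fun x => f x *+ k).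
Proof. by move=> af x; rewrite af mulNrn. Qed.

Let antiD (V : zmodType) (f g : int -> V) :
  zantiperiodic n f -> zantiperiodic n g -> zantiperiodic n (fun x => f x + g x).
Proof. by move=> af ag x; rewrite af ag opprD. Qed.

Let anti_simp := (fermU_anti, fermW_anti, mulrN, mulNr, opprD).

Let smxB1 y : zantiperiodic n (fun x => smx (x - y)).
Proof. exact: antiperiodic_comp_shiftr smx_anti. Qed.
Let smxB2 x : zantiperiodic n (fun y => smx (x - y)).
Proof. exact: antiperiodic_comp_rev smx_anti. Qed.

Lemma fermUU x y : fermU x * fermU y + fermU y * fermU x = smx (x - y) *+ 2.
Proof.
move: x y; apply: (antiperiodic_ext2 n_gt0) => [y|x|y|x|i j lt_in lt_jn].
- exact: antiD (antiML _ fermU_anti) (antiMR _ fermU_anti).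
- exact: antiD (antiMR _ fermU_anti) (antiML _ fermU_anti).
- exact: antiMn 2 (smxB1 y).
- exact: antiMn 2 (smxB2 x).
rewrite /fermU !antiext_nat // /smx tdeltaB //.
case: (ltngtP i j) => [ij|ji|->].
- by rewrite [X in X + _](jwuu _ ij) // addNr raddf0 mul0rn.
- by rewrite [X in _ + X](jwuu _ ji) // addrN raddf0 mul0rn.
- by rewrite [_ * _]jwu_sqr mulr2n.
Qed.

Lemma fermWW x y : fermW x * fermW y + fermW y * fermW x = - (smx (x - y) *+ 2).
Proof.
move: x y; apply: (antiperiodic_ext2 n_gt0) => [y|x|y|x|i j lt_in lt_jn].
- exact: antiD (antiML _ fermW_anti) (antiMR _ fermW_anti).
- exact: antiD (antiMR _ fermW_anti) (antiML _ fermW_anti).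
- exact: antiN (antiMn 2 (smxB1 y)).
- exact: antiN (antiMn 2 (smxB2 x)).
rewrite /fermW !antiext_nat // /smx tdeltaB //.
case: (ltngtP i j) => [ij|ji|->].
- by rewrite [X in X + _](jwww _ ij) // addNr raddf0 mul0rn oppr0.
- by rewrite [X in _ + X](jwww _ ji) // addrN raddf0 mul0rn oppr0.
- by rewrite [_ * _]jww_sqr // mulr2n opprD.
Qed.

Lemma fermUW x y : fermU x * fermW y = - (fermW y * fermU x).
Proof.
move: x y; apply: (antiperiodic_ext2 n_gt0) => [y|x|y|x|i j lt_in lt_jn].
- exact: antiML _ fermU_anti.
- exact: antiMR _ fermW_anti.
- exact: antiN (antiMR _ fermU_anti).
- exact: antiN (antiML _ fermW_anti).
by rewrite /fermU /fermW !antiext_nat //; exact: jwuw.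
Qed.

Lemma cycA_anti : zantiperiodic n cycA.
Proof. exact: onsA_anti fermU_anti. Qed.
Lemma cycG_anti : zantiperiodic n cycG.
Proof. exact: onsG_anti fermU_anti fermW_anti. Qed.

Let smx0 : smx 0 = 1. Proof. by rewrite /smx tdelta0. Qed.
Let smx_small i : (0 < i < n)%N -> smx i%:Z = 0.
Proof. by move=> Hi; rewrite /smx tdelta_small // raddf0. Qed.

Lemma comm_cycAA l m : comm (cycA l) (cycA m) = cycG (l - m) *+ 2.
Proof.
exact: (comm_AA n_gt0 fermU_anti fermW_anti smx_anti smx0 smx_small fermUU fermWW fermUW).
Qed.

Lemma comm_cycAG l r : comm (cycA l) (cycG r) = (cycA (l - r) - cycA (l + r)) *+ 4.
Proof.
exact: (comm_AG n_gt0 fermU_anti fermW_anti smx_anti smx0 smx_small fermUU fermWW fermUW).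
Qed.

(** Over C the factor 2 of [onsG_odd2] cancels entrywise. *)
Lemma cycG_odd r : cycG (- r) = - cycG r.
Proof.
have /matrixP G2 :=
  onsG_odd2 n_gt0 fermU_anti fermW_anti smx_anti smx0 smx_small fermUU fermWW fermUW r.
apply/matrixP => i j; have /eqP := G2 i j.
by rewrite -mulNrn !mulmxnE eqr_pMn2r // => /eqP.
Qed.

Local Notation P := (parityX R n).

Lemma parityX_anticomm_U x : P * fermU x = - (fermU x * P).
Proof.
move: x; apply: (antiperiodic_ind (P := fun x => P * fermU x = - (fermU x * P)) n_gt0).
  by move=> i lt_in; rewrite /fermU antiext_nat //; exact: parityX_jwu.
by move=> x; rewrite !anti_simp; split=> [->|/oppr_inj].
Qed.

Lemma parityX_anticomm_W x : P * fermW x = - (fermW x * P).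
Proof.
move: x; apply: (antiperiodic_ind (P := fun x => P * fermW x = - (fermW x * P)) n_gt0).
  by move=> i lt_in; rewrite /fermW antiext_nat //; exact: parityX_jww.
by move=> x; rewrite !anti_simp; split=> [->|/oppr_inj].
Qed.

Lemma parityX_cycA m : P * cycA m = cycA m * P.
Proof.
rewrite /cycA /onsA mulr_suml mulr_sumr; apply: eq_bigr => j _.
exact: anticommM (parityX_anticomm_W _) (parityX_anticomm_U _).
Qed.

Lemma parityX_cycG m : P * cycG m = cycG m * P.
Proof.
rewrite /cycG /onsG mulr_suml mulr_sumr; apply: eq_bigr => j _.
rewrite mulrDr mulrDl; congr (_ + _).
  exact: anticommM (parityX_anticomm_U _) (parityX_anticomm_U _).
exact: anticommM (parityX_anticomm_W _) (parityX_anticomm_W _).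
Qed.

Lemma X_at_xq (j : 'I_n) : X_at j = xq R n j.
Proof. by []. Qed.

Lemma cycA0 : cycA 0 = - sumX n.
Proof.
rewrite -sumrN; apply: eq_bigr => j _; rewrite addr0 /fermW /fermU !antiext_nat //.
by rewrite X_at_xq xqE // opprK.
Qed.

Definition zlast : M := zq R n n.-1 * zq R n 0.

Lemma Z_at_zq (j : 'I_n) : Z_at j = zq R n j.
Proof. by []. Qed.

(* The Jordan-Wigner image of the bond (n-1, 0) carries the parity operator, so
   [sumZZ n] agrees with [cycA 1] only on the even sector. *)
Lemma cycA1 : cycA 1 - sumZZ n = (P - 1) * zlast.
Proof.
have -> : cycA 1 = \sum_(j < n.-1) jww R n j * jwu R n j.+1 + P * zlast.
  apply: (etrans (sum_ord_last (fun j => fermW j%:Z * fermU (j%:Z + 1)) n_gt0)).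
  apply: (congr2 +%R).
    apply: eq_bigr => j _; have := ltn_ord j => jn.
    rewrite (_ : j%:Z + 1 = j.+1%:Z); last by lia.
    by rewrite /fermW /fermU !antiext_nat //; lia.
  rewrite (_ : n.-1%:Z + 1 = 0%:Z + n%:Z); last by lia.
  rewrite fermU_anti /fermW /fermU !antiext_nat //; last by lia.
  have -> : zlast = - (P * (jww R n n.-1 * jwu R n 0)) by exact: zqzq_last.
  have PP : P * P = 1 by exact: parityX_sqr.
  have cancelP (a : M) : P * - (P * a) = - a by rewrite mulrN mulrA PP mul1r.
  by rewrite cancelP mulrN.
have -> : sumZZ n = \sum_(j < n.-1) jww R n j * jwu R n j.+1 + zlast :> M.
  transitivity (\sum_(j < n) zq R n j * zq R n (j.+1 %% n)).
    by apply: eq_bigr => j _; rewrite !Z_at_zq.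
  apply: (etrans (sum_ord_last (fun j => zq R n j * zq R n (j.+1 %% n)) n_gt0)).
  have -> : (n.-1.+1 %% n = 0)%N by rewrite prednK // modnn.
  apply: (congr2 +%R) => //; apply: eq_bigr => j _; have := ltn_ord j => jn.
  by rewrite modn_small; [apply: zqzq; lia|lia].
by rewrite opprD addrACA addrN add0r mulrBl mul1r.
Qed.


Lemma parityX_zq i : (i < n)%N -> P *m zq R n i = - (zq R n i *m P).
Proof.
move=> lt_in; apply: (tensq_anticomm (m := Ordinal lt_in)) => /=.
  by rewrite eqxx pauliXZ.
by move=> j; rewrite -val_eqE /= => /negbTE ->; rewrite mulmx1 mul1mx.
Qed.

Lemma parityX_zlast : P * zlast = zlast * P.
Proof. by apply: anticommM; apply: parityX_zq; lia. Qed.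

Lemma parityX_sumX : P * sumX n = sumX n * P.
Proof.
by apply: oppr_inj; rewrite -mulrN -mulNr -cycA0 parityX_cycA.
Qed.

Lemma parityX_sumZZ : P * sumZZ n = sumZZ n * P.
Proof.
have -> : sumZZ n = cycA 1 - (P - 1) * zlast by rewrite -cycA1 opprB addrC subrK.
apply: commrB; first exact: parityX_cycA.
apply: commrM; last exact: parityX_zlast.
by apply: commrB; [exact: commr_refl|exact: commr1].
Qed.

Lemma xq_jwu_comm i j : i != j -> xq R n i *m jwu R n j = jwu R n j *m xq R n i.
Proof.
move=> ij; rewrite !tensqM; apply: eq_tensq => k.
case: eqP => [ki|_]; last by rewrite mulmx1 mul1mx.
by rewrite ki (negbTE ij); case: ltnP => _; rewrite ?mulmx1 ?mul1mx.
Qed.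

Lemma xq_jww_comm i j : i != j -> xq R n i *m jww R n j = jww R n j *m xq R n i.
Proof.
move=> ij; rewrite !tensqM; apply: eq_tensq => k.
case: eqP => [ki|_]; last by rewrite mulmx1 mul1mx.
by rewrite ki (negbTE ij); case: ltnP => _; rewrite ?mulmx1 ?mul1mx.
Qed.

Lemma xq_jwu_anticomm i : (i < n)%N ->
  xq R n i *m jwu R n i = - (jwu R n i *m xq R n i).
Proof.
move=> lt_in; apply: (tensq_anticomm (m := Ordinal lt_in)) => /=.
  by rewrite ltnn eqxx pauliXZ.
by move=> k; rewrite -val_eqE /= => /negbTE ->; rewrite mulmx1 mul1mx.
Qed.

Lemma xq_jww_anticomm i : (i < n)%N ->
  xq R n i *m jww R n i = - (jww R n i *m xq R n i).
Proof.
move=> lt_in; apply: (tensq_anticomm (m := Ordinal lt_in)) => /=.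
  by rewrite ltnn eqxx mulmxA pauliXZ mulNmx.
by move=> k; rewrite -val_eqE /= => /negbTE ->; rewrite mulmx1 mul1mx.
Qed.

Definition plusmx : 'M[C]_2 := ket_plus *m mxadj ket_plus.
Local Notation rho := (rho_plus n : M).


Let ket_plusE i : ket_plus i 0 = ((Num.sqrt 2)^-1)%:C%C :> C.
Proof.
by rewrite !mxE; case: i => -[|[|//]] Hi /=; rewrite ?addr0 ?add0r ?mulr1.
Qed.

Lemma plusmxE i j : plusmx i j = 2^-1.
Proof.
rewrite [LHS]mxE big_ord1 [X in _ * X]mxE [X in _ * X]mxE !ket_plusE conjc_real.
by rewrite -rmorphM -invfM -expr2 sqr_sqrtr // fmorphV rmorph_nat.
Qed.

Lemma pauliX_plus : pauliX *m plusmx = plusmx.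
Proof.
apply/matrixP => i j; rewrite mxE !big_ord_recr big_ord0 /= !plusmxE !mxE add0r.
by rewrite -mulrDl; case: i => -[|[|//]] Hi; rewrite /= ?addr0 ?add0r mul1r.
Qed.

Lemma plus_pauliX : plusmx *m pauliX = plusmx.
Proof.
apply/matrixP => i j; rewrite mxE !big_ord_recr big_ord0 /= !plusmxE !mxE add0r.
by rewrite -mulrDr; case: j => -[|[|//]] Hi; rewrite /= ?addr0 ?add0r mulr1.
Qed.

Lemma xq_rho i : xq R n i *m rho = rho.
Proof.
rewrite tensqM; apply: eq_tensq => k; case: eqP => _; rewrite ?mul1mx //.
exact: pauliX_plus.
Qed.

Lemma rho_xq i : rho *m xq R n i = rho.
Proof.
rewrite tensqM; apply: eq_tensq => k; case: eqP => _; rewrite ?mulmx1 //.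
exact: plus_pauliX.
Qed.

Lemma parityX_rho : P *m rho = rho.
Proof. by rewrite tensqM; apply: eq_tensq => k; exact: pauliX_plus. Qed.

Lemma rho_parityX : rho *m P = rho.
Proof. by rewrite tensqM; apply: eq_tensq => k; exact: plus_pauliX. Qed.

Lemma mxtrace_rho : \tr rho = 1.
Proof.
rewrite mxtrace_tensq big1 // => j _.
rewrite /mxtrace !big_ord_recr big_ord0 /= !plusmxE add0r.
by rewrite -mulr2n -[LHS]mulr_natr mulVf // pnatr_eq0.
Qed.

(** [rho] absorbs X_i on either side; moving X_i around the trace shows the value to be its own
    opposite. *)
Lemma mxtrace_rho_anti i (a : M) : xq R n i *m a = - (a *m xq R n i) ->
  \tr (rho *m a) = 0.
Proof.
move=> xa; have H : \tr (rho *m a) = - \tr (rho *m a).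
  rewrite -{1}(rho_xq i) -mulmxA xa mulmxN raddfN /= mulmxA mxtrace_mulC mulmxA.
  by rewrite xq_rho.
by apply/eqP; rewrite -eqNr {1}H opprK.
Qed.

Let phi0 (a : M) : C := \tr (rho *m a).

Let phi0_anti (f : int -> M) : zantiperiodic n f -> zantiperiodic n (phi0 \o f).
Proof. by move=> af x; rewrite /phi0 /= af mulmxN raddfN. Qed.

Let anticomm_commM (p a b : M) : p *m a = - (a *m p) -> p *m b = b *m p ->
  p *m (a *m b) = - (a *m b *m p).
Proof. by move=> pa pb; rewrite mulmxA pa mulNmx -!mulmxA pb. Qed.

Let tdeltaB1 y : zantiperiodic n (fun x => tdelta (x - y)).
Proof. exact: antiperiodic_comp_shiftr tdelta_anti. Qed.
Let tdeltaB2 x : zantiperiodic n (fun y => tdelta (x - y)).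
Proof. exact: antiperiodic_comp_rev tdelta_anti. Qed.

(** For equal sites the product is - X_i, of value -1; for distinct sites X_i anticommutes with w_i
    and commutes with u_j. *)
Lemma rho_fermWU x y : \tr (rho *m (fermW x * fermU y)) = - tdelta (x - y).
Proof.
move: x y; apply: (antiperiodic_ext2 n_gt0) => [y|x|y|x|i j lt_in lt_jn].
- exact: phi0_anti (antiML _ fermW_anti).
- exact: phi0_anti (antiMR _ fermU_anti).
- exact: antiN (tdeltaB1 y).
- exact: antiN (tdeltaB2 x).
rewrite /fermU /fermW !antiext_nat // tdeltaB //; case: eqVneq => [<-|ij].
  rewrite -[jww R n i * _]opprK -[jww R n i * _]/(_ *m _) -xqE //.
  by rewrite mulmxN raddfN /= rho_xq mxtrace_rho.
rewrite oppr0; apply: (mxtrace_rho_anti (i := i)).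
by apply: anticomm_commM; [exact: xq_jww_anticomm|exact: xq_jwu_comm].
Qed.

Lemma rho_fermUU x y : \tr (rho *m (fermU x * fermU y)) = tdelta (x - y).
Proof.
move: x y; apply: (antiperiodic_ext2 n_gt0) => [y|x|y|x|i j lt_in lt_jn].
- exact: phi0_anti (antiML _ fermU_anti).
- exact: phi0_anti (antiMR _ fermU_anti).
- exact: tdeltaB1 y.
- exact: tdeltaB2 x.
rewrite /fermU !antiext_nat // tdeltaB //; case: eqVneq => [<-|ij].
  by rewrite [_ * _]jwu_sqr mulmx1 mxtrace_rho.
apply: (mxtrace_rho_anti (i := i)).
by apply: anticomm_commM; [exact: xq_jwu_anticomm|exact: xq_jwu_comm].
Qed.

Lemma rho_fermWW x y : \tr (rho *m (fermW x * fermW y)) = - tdelta (x - y).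
Proof.
move: x y; apply: (antiperiodic_ext2 n_gt0) => [y|x|y|x|i j lt_in lt_jn].
- exact: phi0_anti (antiML _ fermW_anti).
- exact: phi0_anti (antiMR _ fermW_anti).
- exact: antiN (tdeltaB1 y).
- exact: antiN (tdeltaB2 x).
rewrite /fermW !antiext_nat // tdeltaB //; case: eqVneq => [<-|ij].
  by rewrite [_ * _]jww_sqr // mulmxN mulmx1 raddfN /= mxtrace_rho.
rewrite oppr0; apply: (mxtrace_rho_anti (i := i)).
by apply: anticomm_commM; [exact: xq_jww_anticomm|exact: xq_jww_comm].
Qed.

Lemma rho_cycA m : \tr (rho *m cycA m) = - n%:R * tdelta (- m).
Proof.
rewrite /cycA /onsA mulmx_sumr raddf_sum /=.
under eq_bigr do rewrite rho_fermWU (_ : _ - _ = - m) ?opprD ?addNKr //; last first.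
by rewrite sumr_const card_ord mulNr mulr_natl mulNrn.
Qed.

(** The u u and w w pairs both have offset r and contribute opposite deltas. *)
Lemma rho_cycG r : \tr (rho *m cycG r) = 0.
Proof.
rewrite /cycG /onsG mulmx_sumr raddf_sum /= big1 // => j _.
rewrite mulmxDr mxtraceD.
apply: (etrans (congr2 +%R (rho_fermUU _ _) (rho_fermWW _ _))).
have -> : j%:Z + r - j%:Z = r by lia.
have -> : j%:Z - (j%:Z - r) = r by lia.
exact: addrN.
Qed.

Lemma rho_cycA0 : \tr (rho *m cycA 0) = - n%:R.
Proof. by rewrite rho_cycA oppr0 tdelta0 mulr1. Qed.

Lemma rho_cycA_small i : (0 < i < n)%N -> \tr (rho *m cycA i%:Z) = 0.
Proof.
move=> Hi; rewrite rho_cycA -[tdelta _]opprK -tdelta_anti.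
rewrite (_ : _ + _ = (n - i)%N%:Z); last by lia.
by rewrite tdelta_small ?oppr0 ?mulr0 //; lia.
Qed.

End CycleOnsager.

(** * Complex calculus and the matrix exponential *)

Section ComplexCalculus.
Variable R : realType.
Local Notation C := R[i].
Local Notation Re := (@complex.Re R).
Local Notation Im := (@complex.Im R).
Local Open Scope classical_set_scope.

Lemma cReD (x y : C) : Re (x + y) = Re x + Re y. Proof. by case: x y => ? ? [? ?]. Qed.
Lemma cImD (x y : C) : Im (x + y) = Im x + Im y. Proof. by case: x y => ? ? [? ?]. Qed.
Lemma cReB (x y : C) : Re (x - y) = Re x - Re y. Proof. by case: x y => ? ? [? ?]. Qed.
Lemma cReM (x y : C) : Re (x * y) = Re x * Re y - Im x * Im y.
Proof. by case: x y => ? ? [? ?]. Qed.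
Lemma cImM (x y : C) : Im (x * y) = Re x * Im y + Im x * Re y.
Proof. by case: x y => ? ? [? ?]. Qed.
Lemma cReZ (a : R) (x : C) : Re (a%:C%C * x) = a * Re x.
Proof. by rewrite cReM /= mul0r subr0. Qed.
Lemma cImZ (a : R) (x : C) : Im (a%:C%C * x) = a * Im x.
Proof. by rewrite cImM /= mul0r addr0. Qed.
Lemma cRe_sum I r (p : pred I) (F : I -> C) :
  Re (\sum_(i <- r | p i) F i) = \sum_(i <- r | p i) Re (F i).
Proof. exact: (big_morph Re cReD erefl). Qed.
Lemma cIm_sum I r (p : pred I) (F : I -> C) :
  Im (\sum_(i <- r | p i) F i) = \sum_(i <- r | p i) Im (F i).
Proof. exact: (big_morph Im cImD erefl). Qed.
Lemma cReJ (x : C) : Re (conjc x) = Re x. Proof. by case: x. Qed.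
Lemma cImJ (x : C) : Im (conjc x) = - Im x. Proof. by case: x. Qed.
Lemma cImB (x y : C) : Im (x - y) = Im x - Im y. Proof. by case: x y => ? ? [? ?]. Qed.
Lemma normc_ge_Im (z : C) : (`|Im z|)%:C%C <= `|z|.
Proof.
have -> : `|Im z| = `|Re ('i%C * z)|.
  by rewrite cReM /= mul0r mul1r sub0r normrN.
apply: le_trans (normc_ge_Re _) _; rewrite normrM.
suff -> : `|'i%C : C| = 1 by rewrite mul1r.
by rewrite normc_def /= expr0n /= expr1n add0r sqrtr1.
Qed.
Lemma complex_ext (x y : C) : Re x = Re y -> Im x = Im y -> x = y.
Proof. by case: x y => ? ? [? ?] /= -> ->. Qed.

(** Stated on real and imaginary parts, so that real calculus applies, in particular the constancy
    of a function with zero derivative. *)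
Definition cderiv (f f' : R -> C) := forall t,
  is_derive t (1 : R) (Re \o f) (Re (f' t)) /\
  is_derive t (1 : R) (Im \o f) (Im (f' t)).

Lemma cderiv_ext f f' g g' : f =1 g -> f' =1 g' -> cderiv f f' -> cderiv g g'.
Proof. by move=> /funext <- /funext <-. Qed.

Lemma cderiv_cst c : cderiv (fun=> c) (fun=> 0).
Proof. by move=> t; split; exact: is_derive_cst. Qed.

Lemma cderivD f f' g g' : cderiv f f' -> cderiv g g' ->
  cderiv (fun t => f t + g t) (fun t => f' t + g' t).
Proof.
move=> df dg t; have [fr fi] := df t; have [gr gi] := dg t; split.
  by rewrite cReD (_ : _ \o _ = (Re \o f) + (Re \o g)); [exact: is_deriveD|
    apply/funext => x /=; rewrite cReD].
by rewrite cImD (_ : _ \o _ = (Im \o f) + (Im \o g)); [exact: is_deriveD|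
    apply/funext => x /=; rewrite cImD].
Qed.

Let is_derive_mul (a b : R -> R) (t da db : R) :
  is_derive t (1 : R) a da -> is_derive t (1 : R) b db ->
  is_derive t (1 : R) (a * b) (da * b t + a t * db).
Proof.
move=> Da Db; have -> : da * b t + a t * db = a t *: db + b t *: da.
  by rewrite addrC [da * _]mulrC.
exact: is_deriveM.
Qed.

Lemma cderivM f f' g g' : cderiv f f' -> cderiv g g' ->
  cderiv (fun t => f t * g t) (fun t => f' t * g t + f t * g' t).
Proof.
move=> df dg t; have [fr fi] := df t; have [gr gi] := dg t; split.
  rewrite (_ : _ \o _ = (Re \o f) * (Re \o g) - (Im \o f) * (Im \o g)); last first.
    by apply/funext => x /=; rewrite cReM.
  rewrite cReD !cReM addrACA -opprD.
  exact: is_deriveB (is_derive_mul fr gr) (is_derive_mul fi gi).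
rewrite (_ : _ \o _ = (Re \o f) * (Im \o g) + (Im \o f) * (Re \o g)); last first.
  by apply/funext => x /=; rewrite cImM.
rewrite cImD !cImM addrACA.
exact: is_deriveD (is_derive_mul fr gi) (is_derive_mul fi gr).
Qed.

Lemma cderiv_sum (I : Type) (r : seq I) (p : pred I) (f f' : I -> R -> C) :
  (forall i, cderiv (f i) (f' i)) ->
  cderiv (fun t => \sum_(i <- r | p i) f i t) (fun t => \sum_(i <- r | p i) f' i t).
Proof.
move=> df; elim: r => [|i r IHr].
  by apply: cderiv_ext (cderiv_cst 0) => t; rewrite big_nil.
case: (boolP (p i)) => pi.
  by apply: cderiv_ext (cderivD (df i) IHr) => t; rewrite big_cons pi.
by apply: cderiv_ext IHr => t; rewrite big_cons (negbTE pi).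
Qed.

Lemma cderiv_conj f f' : cderiv f f' ->
  cderiv (fun t => conjc (f t)) (fun t => conjc (f' t)).
Proof.
move=> df t; have [fr fi] := df t; rewrite cReJ cImJ; split.
  by have -> : Re \o (fun t => conjc (f t)) = Re \o f
    by apply/funext => x /=; rewrite cReJ.
have -> : Im \o (fun t => conjc (f t)) = - (Im \o f)
  by apply/funext => x /=; rewrite cImJ.
exact: is_deriveN.
Qed.

Lemma cderiv_eq0 f t : cderiv f (fun=> 0) -> f t = f 0.
Proof.
move=> df; apply: complex_ext.
  by apply: (@is_derive_0_is_cst _ (Re \o f)) => x; have [] := df x.
by apply: (@is_derive_0_is_cst _ (Im \o f)) => x; have [] := df x.
Qed.

Lemma cderiv_unique f f' g' : cderiv f f' -> cderiv f g' -> f' =1 g'.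
Proof.
move=> df dg t; have [fr fi] := df t; have [gr gi] := dg t.
by apply: complex_ext; rewrite -?(@derive_val _ _ _ _ _ _ _ fr) -?(@derive_val _ _ _ _ _ _ _ fi) derive_val.
Qed.

Lemma cvg_complex T (F : set_system T) {FF : Filter F} (u : T -> C^o) (l : C) :
  (Re \o u) @ F --> Re l -> (Im \o u) @ F --> Im l -> u @ F --> (l : C^o).
Proof.
move=> /cvgrPdist_lt ur /cvgrPdist_lt ui; apply/cvgrPdist_lt => e.
rewrite ltcE /= => /andP[/eqP e_im e_re].
have e2 : 0 < Re e / 2 by rewrite divr_gt0.
near=> k; have rk : `|Re l - Re (u k)| < Re e / 2 by near: k; exact: ur.
have ik : `|Im l - Im (u k)| < Re e / 2 by near: k; exact: ui.
have -> : e = (Re e)%:C%C by apply: complex_ext; rewrite //= e_im.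
set z := l - u k.
have -> : z = (Re z)%:C%C + 'i%C * (Im z)%:C%C by rewrite -complexE.
apply: le_lt_trans (ler_normD _ _) _; rewrite normrM !normc_def /=.
rewrite !expr0n /= expr1n !addr0 add0r sqrtr1 mul1r !sqrtr_sqr -rmorphD /= ltcR.
rewrite [ltRHS]splitr ltrD //; rewrite /z ?(cReD, cImD);
  by case: (u k) rk ik => ? ? /= ? ?.
Unshelve. all: by end_near. Qed.

End ComplexCalculus.

Section MatrixExponential.
Variables (R : realType) (N : nat).
Local Notation C := R[i].
Local Notation Re := (@complex.Re R).
Local Notation Im := (@complex.Im R).
Local Open Scope classical_set_scope.
Implicit Types A B : 'M[C]_N.

(** The total modulus of all entries dominates every row sum, so multiplying by A costs at most a
    factor [b]. *)
Lemma mxpow_bound A : exists2 b : R, 0 <= b &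
  forall k i j, `|(A ^+ k) i j| <= (b ^+ k)%:C%C.
Proof.
pose b : C := \sum_i \sum_j `|A i j|.
have b0 : 0 <= b by apply: sumr_ge0 => i _; apply: sumr_ge0.
have bE : b = (Re b)%:C%C by move: b0; rewrite lecE => /andP[/eqP bi _]; exact: complex_ext.
have rb0 : 0 <= Re b by move: b0; rewrite lecE => /andP[].
exists (Re b) => // k i j.
have -> : (Re b ^+ k)%:C%C = b ^+ k by rewrite [in RHS]bE -rmorphXn.
elim: k i j => [|k IHk] i j.
  by rewrite !expr0 mxE normr_nat; case: (i == j).
rewrite exprS -[A * _]/(A *m _) mxE exprS.
apply: le_trans (ler_norm_sum _ _ _) _.
apply: (@le_trans _ _ (\sum_l `|A i l| * b ^+ k)).
  by apply: ler_sum => l _; rewrite normrM ler_wpM2l.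
rewrite -mulr_suml ler_wpM2r ?exprn_ge0 // /b [leRHS](bigD1 i) //= lerDl.
by apply: sumr_ge0 => *; apply: sumr_ge0.
Qed.

Lemma cvg_pseries_exp (c : R ^nat) (b B x : R) : 0 <= b -> 0 <= B ->
  (forall k, `|c k| <= B * b ^+ k / k`!%:R) -> cvgn (pseries c x).
Proof.
move=> b0 B0 cb; apply: normed_cvg.
apply: (@series_le_cvg _ _ (fun k => B * exp_coeff (b * `|x|) k)) => [k|k|k|].
- exact: normr_ge0.
- by rewrite mulr_ge0 // exp_coeff_ge0 // mulr_ge0.
- rewrite /= normrM normrX /exp_coeff /= exprMn.
  apply: le_trans (ler_wpM2r (exprn_ge0 k (normr_ge0 x)) (cb k)) _.
  by rewrite le_eqVlt; apply/orP; left; apply/eqP; ring.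
- exact: is_cvg_seriesZ (is_cvg_series_exp_coeff _).
Qed.

(** Taylor coefficients of an entry of A^s exp(tA), seen through [f], which will be the real or the
    imaginary part. Formal differentiation raises [s] by one. *)
Definition shiftc (A : 'M[C]_N) i j (f : C -> R) s (k : nat) : R :=
  (k`!%:R)^-1 * f ((A ^+ (k + s)) i j).

Lemma shiftc_diffs A i j f s : pseries_diffs (shiftc A i j f s) = shiftc A i j f s.+1.
Proof.
apply/funext => k; rewrite /pseries_diffs /shiftc factS natrM invfM addSnnS mulrA.
by congr (_ * _); rewrite mulrA mulfV ?mul1r // pnatr_eq0.
Qed.

Lemma cvg_shiftc A i j f s x : (forall z, (`|f z|)%:C%C <= `|z|) ->
  cvgn (pseries (shiftc A i j f s) x).
Proof.
move=> fz; have [b b0 Ab] := mxpow_bound A.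
apply: (@cvg_pseries_exp _ b (b ^+ s)) => //; first exact: exprn_ge0.
move=> k; rewrite /shiftc normrM ger0_norm ?invr_ge0 // mulrC ler_wpM2r ?invr_ge0 //.
by rewrite -exprD addnC -lecR; apply: le_trans (fz _) (Ab _ _ _).
Qed.

Let Re_le (z : C) : (`|Re z|)%:C%C <= `|z|. Proof. exact: normc_ge_Re. Qed.
Let Im_le (z : C) : (`|Im z|)%:C%C <= `|z|. Proof. exact: normc_ge_Im. Qed.

Definition expcoef (A : 'M[C]_N) s i j (t : R) (k : nat) : C^o :=
  (k`!%:R)^-1 * (t ^+ k)%:C%C * (A ^+ (k + s)) i j.

Definition explim (A : 'M[C]_N) s i j (t : R) : C :=
  (limn (pseries (shiftc A i j Re s) t) +i* limn (pseries (shiftc A i j Im s) t))%C.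

Lemma cvg_expcoef A s i j t :
  series (expcoef A s i j t) @ \oo --> (explim A s i j t : C^o).
Proof.
have cE k : (k`!%:R : C)^-1 * (t ^+ k)%:C%C = ((k`!%:R)^-1 * t ^+ k)%:C%C.
  by rewrite rmorphM fmorphV rmorph_nat.
apply: cvg_complex => /=.
  have -> : Re \o series (expcoef A s i j t) = pseries (shiftc A i j Re s) t.
    apply/funext => m; rewrite /series /pseries /= cRe_sum; apply: eq_bigr => k _.
    by rewrite /expcoef cE cReZ /shiftc mulrAC.
  exact: cvg_shiftc.
have -> : Im \o series (expcoef A s i j t) = pseries (shiftc A i j Im s) t.
  apply/funext => m; rewrite /series /pseries /= cIm_sum; apply: eq_bigr => k _.
  by rewrite /expcoef cE cImZ /shiftc mulrAC.
exact: cvg_shiftc.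
Qed.

Lemma expmx_explim A (t : R) i j : expmx (t%:C%C *: A) i j = explim A 0 i j t.
Proof.
rewrite [LHS]mxE.
apply: etrans (cvg_lim (@norm_hausdorff _ C^o) (@cvg_expcoef A 0 i j t)).
congr (limn (series _)); apply/funext => k; rewrite /expcoef addn0 -mulrA; congr (_ * _).
suff -> : (t%:C%C *: A) ^+ k = (t ^+ k)%:C%C *: A ^+ k by rewrite mxE.
elim: k => [|k IHk]; first by rewrite !expr0 scale1r.
rewrite !exprS IHk -[LHS]/(_ *m _) -scalemxAl -scalemxAr scalerA.
by rewrite rmorphM.
Qed.

Lemma mul_expmx_explim A (t : R) i j :
  (A *m expmx (t%:C%C *: A)) i j = explim A 1 i j t.
Proof.
rewrite [LHS]mxE.
suff lim1 : series (expcoef A 1 i j t) @ \oo -->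
    (\sum_l A i l * expmx (t%:C%C *: A) l j : C^o).
  have hC := @norm_hausdorff _ C^o.
  exact: etrans (esym (cvg_lim hC lim1)) (cvg_lim hC (@cvg_expcoef A 1 i j t)).
have -> : series (expcoef A 1 i j t) =
    \sum_l (fun m => A i l * series (expcoef A 0 l j t) m : C^o).
  apply/funext => m; rewrite fct_sumE /series /=.
  under [RHS]eq_bigr do rewrite mulr_sumr.
  rewrite exchange_big /=; apply: eq_bigr => k _.
  rewrite /expcoef addn1 addn0 exprS -[A * _]/(A *m _) mxE mulr_sumr.
  by apply: eq_bigr => l _; rewrite mulrCA.
apply: (big_ind2 (fun (u : nat -> C^o) (l : C^o) => u @ \oo --> l)) => [||l _].
- exact: cvg_cst.
- by move=> u1 l1 u2 l2; exact: cvgD.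
apply: cvgM; first exact: cvg_cst.
by rewrite expmx_explim; exact: cvg_expcoef.
Qed.

Lemma cderiv_expmx A i j :
  cderiv (fun t => expmx (t%:C%C *: A) i j)
    (fun t => (A *m expmx (t%:C%C *: A)) i j).
Proof.
move=> t; rewrite mul_expmx_explim.
have D f : (forall z, (`|f z|)%:C%C <= `|z|) ->
    is_derive t (1 : R) (fun t => limn (pseries (shiftc A i j f 0) t))
      (limn (pseries (shiftc A i j f 1) t)).
  (* Termwise differentiation at t asks for convergence of the series and of its first two formal
     derivatives at some point beyond |t|. *)
  move=> fz; rewrite -shiftc_diffs; apply: (@pseries_snd_diffs _ _ (`|t| + 1)).
  - exact: cvg_shiftc.
  - by rewrite shiftc_diffs; exact: cvg_shiftc.
  - by rewrite !shiftc_diffs; exact: cvg_shiftc.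
  - by rewrite [ltRHS]ger0_norm ?addr_ge0 // ltrDl.
split.
  rewrite (_ : _ \o _ = fun t => limn (pseries (shiftc A i j Re 0) t)); first exact: D.
  by apply/funext => x /=; rewrite expmx_explim.
rewrite (_ : _ \o _ = fun t => limn (pseries (shiftc A i j Im 0) t)); first exact: D.
by apply/funext => x /=; rewrite expmx_explim.
Qed.

Lemma expmx0 : expmx (0 : 'M[C]_N) = 1%:M.
Proof.
apply/matrixP => i j; rewrite [LHS]mxE; apply: (@norm_lim_near_cst _ C^o).
(* The empty partial sum is 0; the partial sums are constantly the identity only from m = 1 on. *)
near=> m; have -> : m = m.-1.+1 by rewrite prednK //; near: m; exists 1%N.
rewrite /series /= big_nat_recl //= big1 ?addr0 => [|k _].
  by rewrite fact0 expr0 invr1 mul1r.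
by rewrite expr0n /= mxE mulr0.
Unshelve. all: by end_near. Qed.

End MatrixExponential.

(** * One-parameter flows of skew-Hermitian matrices *)

Section MatrixFlows.
Variable R : realType.
Local Notation C := R[i].

Lemma mxadjM m n p (A : 'M[C]_(m, n)) (B : 'M[C]_(n, p)) :
  mxadj (A *m B) = mxadj B *m mxadj A.
Proof. by rewrite /mxadj /mxconj map_mxM trmx_mul. Qed.

Lemma unitary_mulmx n (V W : 'M[C]_n) : mxadj V *m V = 1%:M ->
  mxadj W *m W = 1%:M -> mxadj (V *m W) *m (V *m W) = 1%:M.
Proof.
by move=> VU WU; rewrite mxadjM mulmxA -[mxadj W *m _ *m _]mulmxA VU mulmx1.
Qed.

Lemma mxadjK m n (A : 'M[C]_(m, n)) : mxadj (mxadj A) = A.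
Proof. by apply/matrixP => i j; rewrite !mxE conjcK. Qed.

Lemma mxadjD m n (A B : 'M[C]_(m, n)) : mxadj (A + B) = mxadj A + mxadj B.
Proof. by apply/matrixP => i j; rewrite !mxE rmorphD. Qed.

Lemma mxadjZ m n c (A : 'M[C]_(m, n)) : mxadj (c *: A) = conjc c *: mxadj A.
Proof. by apply/matrixP => i j; rewrite !mxE rmorphM. Qed.

Lemma mxadjB m n (A B : 'M[C]_(m, n)) : mxadj (A - B) = mxadj A - mxadj B.
Proof. by apply/matrixP => i j; rewrite !mxE rmorphB. Qed.

Lemma mxadj_sum m n I r (P : pred I) (F : I -> 'M[C]_(m, n)) :
  mxadj (\sum_(i <- r | P i) F i) = \sum_(i <- r | P i) mxadj (F i).
Proof.
apply: (big_morph _ (@mxadjD m n)).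
by apply/matrixP => i j; rewrite !mxE rmorph0.
Qed.

Definition mxderiv m n (F F' : R -> 'M[C]_(m, n)) :=
  forall i j, cderiv (fun t => F t i j) (fun t => F' t i j).

Lemma mxderiv_ext m n (F F' G G' : R -> 'M[C]_(m, n)) :
  F =1 G -> F' =1 G' -> mxderiv F F' -> mxderiv G G'.
Proof. by move=> /funext <- /funext <-. Qed.

Lemma mxderiv_cst m n (A : 'M[C]_(m, n)) : mxderiv (fun=> A) (fun=> 0).
Proof.
by move=> i j; apply: cderiv_ext (cderiv_cst (A i j)) => t //; rewrite mxE.
Qed.

Lemma mxderivM m n p (F F' : R -> 'M[C]_(m, n)) (G G' : R -> 'M[C]_(n, p)) :
  mxderiv F F' -> mxderiv G G' ->
  mxderiv (fun t => F t *m G t) (fun t => F' t *m G t + F t *m G' t).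
Proof.
move=> dF dG i j; apply: (cderiv_ext (f := fun t => \sum_k F t i k * G t k j)
  (f' := fun t => \sum_k (F' t i k * G t k j + F t i k * G' t k j))) => [t|t|].
- by rewrite mxE.
- by rewrite !mxE -big_split.
- by apply: cderiv_sum => k; exact: cderivM.
Qed.

Lemma mxderiv_adj m n (F F' : R -> 'M[C]_(m, n)) :
  mxderiv F F' -> mxderiv (fun t => mxadj (F t)) (fun t => mxadj (F' t)).
Proof.
move=> dF i j; apply: cderiv_ext (cderiv_conj (dF j i)) => t; by rewrite !mxE.
Qed.

Lemma cderiv_trace n (F F' : R -> 'M[C]_n) :
  mxderiv F F' -> cderiv (fun t => \tr (F t)) (fun t => \tr (F' t)).
Proof. by move=> dF; apply: cderiv_sum => i. Qed.

Lemma mxderiv_eq0 m n (F : R -> 'M[C]_(m, n)) t :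
  mxderiv F (fun=> 0) -> F t = F 0.
Proof.
move=> dF; apply/matrixP => i j; apply: (@cderiv_eq0 _ (fun t => F t i j)).
by apply: cderiv_ext (dF i j) => // x; rewrite mxE.
Qed.

Variable N : nat.
Implicit Types A B K M O : 'M[C]_N.

Definition flow K (t : R) : 'M[C]_N := expmx (t%:C%C *: K).

Lemma flow0 K : flow K 0 = 1%:M. Proof. by rewrite /flow scale0r expmx0. Qed.
Lemma flow1 K : flow K 1 = expmx K. Proof. by rewrite /flow scale1r. Qed.

Lemma mxderiv_flow K : mxderiv (flow K) (fun t => K *m flow K t).
Proof. by move=> i j; exact: cderiv_expmx. Qed.

Lemma mxadj1 n : mxadj (1%:M : 'M[C]_n) = 1%:M.
Proof. by apply/matrixP => i j; rewrite !mxE rmorph_nat eq_sym. Qed.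

(** The Heisenberg picture: the observable evolves by conjugation, and skewness of [K] turns the
    derivative into a commutator. *)
Lemma flow_adj_deriv K O : mxadj K = - K ->
  mxderiv (fun t => mxadj (flow K t) *m O *m flow K t)
    (fun t => mxadj (flow K t) *m (O *m K - K *m O) *m flow K t).
Proof.
move=> Kskew.
have dE := mxderiv_flow K; have dO := mxderiv_cst O.
apply: mxderiv_ext (mxderivM (mxderivM (mxderiv_adj dE) dO) dE) => [//|t /=].
rewrite mulmx0 addr0 mxadjM Kskew mulmxN !mulNmx mulmxBr mulmxBl addrC.
by rewrite !mulmxA.
Qed.

(** The derivative of the evolved observable vanishes. The case O = 1 gives unitarity. *)
Lemma flow_conserved K O t : mxadj K = - K -> K *m O = O *m K ->
  mxadj (flow K t) *m O *m flow K t = O.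
Proof.
move=> Kskew KO; have -> : mxadj (flow K t) *m O *m flow K t =
    mxadj (flow K 0) *m O *m flow K 0.
  apply: (@mxderiv_eq0 _ _ (fun t => mxadj (flow K t) *m O *m flow K t)).
  apply: mxderiv_ext (flow_adj_deriv O Kskew) => // x.
  by rewrite KO subrr mulmx0 mul0mx.
by rewrite flow0 mxadj1 mul1mx mulmx1.
Qed.

Lemma flow_unitary K t : mxadj K = - K -> mxadj (flow K t) *m flow K t = 1%:M.
Proof.
move=> Kskew.
have := flow_conserved t Kskew (etrans (mulmx1 K) (esym (mul1mx K))).
by rewrite mulmx1.
Qed.

Lemma flow_comm K O t : mxadj K = - K -> K *m O = O *m K ->
  O *m flow K t = flow K t *m O.
Proof.
move=> Kskew KO; have U := mulmx1C (flow_unitary t Kskew).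
by rewrite -[in RHS](flow_conserved t Kskew KO) !mulmxA U mul1mx.
Qed.

Lemma flow_state_deriv K M : mxadj K = - K ->
  mxderiv (fun t => flow K t *m M *m mxadj (flow K t))
    (fun t => K *m (flow K t *m M *m mxadj (flow K t))
              - flow K t *m M *m mxadj (flow K t) *m K).
Proof.
move=> Kskew; have dE := mxderiv_flow K; have dM := mxderiv_cst M.
apply: mxderiv_ext (mxderivM (mxderivM dE dM) (mxderiv_adj dE)) => [//|t /=].
by rewrite mulmx0 addr0 mxadjM Kskew !mulmxN !mulmxA.
Qed.

End MatrixFlows.

(** Common interface for continuity and for bounded measurability: once the entries of a matrix
    function have the property, so has every polynomial in them and their conjugates. *)
Record star_closed (R : realType) T (F : (T -> R[i]) -> Prop) : Prop := StarClosed {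
  star_cst : forall c, F (fun=> c);
  star_add : forall f g, F f -> F g -> F (fun x => f x + g x);
  star_mul : forall f g, F f -> F g -> F (fun x => f x * g x);
  star_conj : forall f, F f -> F (fun x => conjc (f x)) }.

Section StarClosed.
Variables (R : realType) (T : Type) (F : (T -> R[i]) -> Prop).
Hypothesis FS : star_closed F.
Local Notation C := R[i].

Lemma star_sum (I : Type) (r : seq I) (p : pred I) (f : I -> T -> C) :
  (forall i, F (f i)) -> F (fun x => \sum_(i <- r | p i) f i x).
Proof.
move=> Ff; elim: r => [|i r IHr].
  rewrite (_ : (fun _ => _) = fun=> 0); first exact: star_cst.
  by apply/funext => x; rewrite big_nil.
rewrite (_ : (fun _ => _) = if p i then fun x => f i x + \sum_(i <- r | p i) f i x
    else fun x => \sum_(i <- r | p i) f i x); last first.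
  by apply/funext => x; rewrite big_cons; case: (p i).
by case: (p i) => //; exact: star_add.
Qed.

Definition mxstar m n (V : T -> 'M[C]_(m, n)) := forall i j, F (fun x => V x i j).

Lemma mxstar_cst m n (A : 'M[C]_(m, n)) : mxstar (fun=> A).
Proof. by move=> i j; exact: star_cst. Qed.

Lemma mxstarM m n p (V : T -> 'M[C]_(m, n)) (W : T -> 'M[C]_(n, p)) :
  mxstar V -> mxstar W -> mxstar (fun x => V x *m W x).
Proof.
move=> FV FW i j; rewrite (_ : (fun _ => _) = fun x => \sum_k V x i k * W x k j).
  by apply: star_sum => k; exact: star_mul.
by apply/funext => x; rewrite mxE.
Qed.

Lemma mxstar_adj m n (V : T -> 'M[C]_(m, n)) :
  mxstar V -> mxstar (fun x => mxadj (V x)).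
Proof.
move=> FV i j; rewrite (_ : (fun _ => _) = fun x => conjc (V x j i)).
  exact: star_conj.
by apply/funext => x; rewrite !mxE.
Qed.

Lemma star_trace n (V : T -> 'M[C]_n) : mxstar V -> F (fun x => \tr (V x)).
Proof. by move=> FV; apply: star_sum => i. Qed.

End StarClosed.

(** * Continuity, measurability and Haar moments *)

Local Open Scope classical_set_scope.

Section ComplexContinuity.
Variable R : realType.
Local Notation C := R[i].
Local Notation Re := (@complex.Re R).
Local Notation Im := (@complex.Im R).

Definition ccontinuous (T : topologicalType) (f : T -> C) :=
  continuous (Re \o f) /\ continuous (Im \o f).

Lemma ccontinuous_star (T : topologicalType) : star_closed (@ccontinuous T).
Proof.
split=> [c|f g [fr fi] [gr gi]|f g [fr fi] [gr gi]|f [fr fi]].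
- by split=> x; exact: cvg_cst.
- split=> x.
    rewrite (_ : Re \o _ = (Re \o f) \+ (Re \o g)).
      by apply: continuousD; [exact: fr|exact: gr].
    by apply/funext => y /=; rewrite cReD.
  rewrite (_ : Im \o _ = (Im \o f) \+ (Im \o g)).
    by apply: continuousD; [exact: fi|exact: gi].
  by apply/funext => y /=; rewrite cImD.
- split=> x.
    rewrite (_ : Re \o _ = (Re \o f) \* (Re \o g) \- (Im \o f) \* (Im \o g)).
      by apply: continuousB; apply: continuousM;
        [exact: fr|exact: gr|exact: fi|exact: gi].
    by apply/funext => y /=; rewrite cReM.
  rewrite (_ : Im \o _ = (Re \o f) \* (Im \o g) \+ (Im \o f) \* (Re \o g)).
    by apply: continuousD; apply: continuousM;
      [exact: fr|exact: gi|exact: fi|exact: gr].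
  by apply/funext => y /=; rewrite cImM.
- split=> x.
    by rewrite (_ : Re \o _ = Re \o f) //; apply/funext => y /=; rewrite cReJ.
  rewrite (_ : Im \o _ = \- (Im \o f)).
    by apply: continuousN; exact: fi.
  by apply/funext => y /=; rewrite cImJ.
Qed.

Lemma Re_continuous : continuous (Re : C^o -> R).
Proof.
move=> z; have FF : Filter (nbhs (z : C^o)) by exact: nbhs_filter.
apply/(@cvgrPdist_lt _ _ _ _ FF) => e e0.
have near_z (d : C) : 0 < d -> nbhs (z : C^o) [set w : C | `|z - w| < d].
  by move=> d0; apply/(@nbhs_normP _ C^o); exists d.
near=> w; rewrite -ltcR; apply: (@le_lt_trans _ _ `|z - w|); last first.
  by near: w; apply: near_z; rewrite ltcR.
by rewrite -cReB; exact: normc_ge_Re.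
Unshelve. all: by end_near. Qed.

Lemma Im_continuous : continuous (Im : C^o -> R).
Proof.
move=> z; have FF : Filter (nbhs (z : C^o)) by exact: nbhs_filter.
apply/(@cvgrPdist_lt _ _ _ _ FF) => e e0.
have near_z (d : C) : 0 < d -> nbhs (z : C^o) [set w : C | `|z - w| < d].
  by move=> d0; apply/(@nbhs_normP _ C^o); exists d.
near=> w; rewrite -ltcR; apply: (@le_lt_trans _ _ `|z - w|); last first.
  by near: w; apply: near_z; rewrite ltcR.
by rewrite -cImB; exact: normc_ge_Im.
Unshelve. all: by end_near. Qed.

Lemma ccontinuous_cvg (T : topologicalType) (f : T -> C) :
  ccontinuous f -> continuous (f : T -> C^o).
Proof.
case=> fr fi x; apply: (@cvg_complex _ _ _ (nbhs_filter x)).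
  exact: fr.
exact: fi.
Qed.

Variable N : nat.

Lemma ccontinuous_entries : mxstar (@ccontinuous 'M[C^o]_N) (fun V => V).
Proof.
move=> i j; split=> V.
  exact: (continuous_comp (@coord_continuous C^o N N i j V) (@Re_continuous _)).
exact: (continuous_comp (@coord_continuous C^o N N i j V) (@Im_continuous _)).
Qed.

(** The solution set of a continuous equation is closed; this carries identities from the connected
    subgroup to its closure. *)
Lemma ccontinuous_closure (G : set 'M[C]_N) (f : 'M[C^o]_N -> C) c :
  ccontinuous f -> (forall V, G V -> f V = c) -> forall V, mx_closure G V -> f V = c.
Proof.
move=> [fr fi] fG V GV.
have cr : closed ((Re \o f) @^-1` [set Re c]).
  by apply: closed_comp => [V' _|]; [exact: fr|exact: closed_eq].
have ci : closed ((Im \o f) @^-1` [set Im c]).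
  by apply: closed_comp => [V' _|]; [exact: fi|exact: closed_eq].
apply: complex_ext.
  have : closure ((Re \o f) @^-1` [set Re c]) V.
    by apply: closureS GV => W GW /=; rewrite fG.
  by rewrite -(closure_id _).1.
have : closure ((Im \o f) @^-1` [set Im c]) V.
  by apply: closureS GV => W GW /=; rewrite fG.
by rewrite -(closure_id _).1.
Qed.

Lemma mulmx_continuous (W : 'M[C]_N) :
  continuous ((fun V => W *m V) : 'M[C^o]_N -> 'M[C^o]_N).
Proof.
move=> V A [P PV PA]; rewrite /nbhs /=.
have FF : Filter (nbhs (V : 'M[C^o]_N)) by exact: nbhs_filter.
have near_ij : nbhs (V : 'M[C^o]_N) [set V' | forall ij : 'I_N * 'I_N,
    P ij.1 ij.2 ((W *m V') ij.1 ij.2)].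
  apply: (@filter_forall _ _ _ _ FF) => -[i j] /=.
  have cW : continuous (fun V' : 'M[C^o]_N => (W *m V') i j : C^o).
    have cWV := mxstarM (ccontinuous_star _) (mxstar_cst (ccontinuous_star _) W)
      ccontinuous_entries i j.
    exact: (ccontinuous_cvg cWV).
  exact: (cW V _ (PV i j)).
by apply: (@filterS _ _ FF _ _ _ near_ij) => V' PV'; apply: PA => i j; exact: (PV' (i, j)).
Qed.

End ComplexContinuity.

(** * Expectations of functions bounded on a set of full measure *)

Section BoundedMeasurable.
Variables (R : realType) (d : measure_display) (T : measurableType d).
Variables (P : probability T R) (D : set T).
Hypotheses (mD : measurable D) (PD : P D = 1%E).
Local Notation C := R[i].
Local Notation Re := (@complex.Re R).
Local Notation Im := (@complex.Im R).
Local Notation E := (cexpectation P).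

(** Boundedness is asked only on [D]: the Haar measure lives on all matrices, whose entries are
    unbounded, but it is carried by a set of unitaries. *)
Definition rbounded (f : T -> R) :=
  measurable_fun setT f /\ exists K, forall x, D x -> `|f x| <= K.

Definition cbounded (f : T -> C) := rbounded (Re \o f) /\ rbounded (Im \o f).

Lemma rbounded_cst c : rbounded (fun=> c).
Proof. by split; [exact: measurable_cst|exists `|c|]. Qed.

Lemma rboundedD f g : rbounded f -> rbounded g -> rbounded (f \+ g).
Proof.
move=> [mf [K Kf]] [mg [L Lg]]; split; first exact: measurable_funD.
exists (K + L) => x Dx; apply: le_trans (ler_normD _ _) _.
by apply: lerD; [exact: Kf|exact: Lg].
Qed.

Lemma rboundedN f : rbounded f -> rbounded (\- f).
Proof.
move=> [mf [K Kf]]; split; first exact: measurableT_comp.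
by exists K => x Dx /=; rewrite normrN Kf.
Qed.

Lemma rboundedM f g : rbounded f -> rbounded g -> rbounded (f \* g).
Proof.
move=> [mf [K Kf]] [mg [L Lg]]; split; first exact: measurable_funM.
by exists (K * L) => x Dx /=; rewrite normrM ler_pM // ?Kf ?Lg.
Qed.

Lemma cbounded_star : star_closed cbounded.
Proof.
split=> [c|f g [fr fi] [gr gi]|f g [fr fi] [gr gi]|f [fr fi]].
- by split; exact: rbounded_cst.
- split.
    rewrite (_ : Re \o _ = (Re \o f) \+ (Re \o g)); first exact: rboundedD.
    by apply/funext => y /=; rewrite cReD.
  rewrite (_ : Im \o _ = (Im \o f) \+ (Im \o g)); first exact: rboundedD.
  by apply/funext => y /=; rewrite cImD.
- split.
    rewrite (_ : Re \o _ = (Re \o f) \* (Re \o g) \+ \- ((Im \o f) \* (Im \o g))).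
      by apply: rboundedD; [exact: rboundedM|apply: rboundedN; exact: rboundedM].
    by apply/funext => y /=; rewrite cReM.
  rewrite (_ : Im \o _ = (Re \o f) \* (Im \o g) \+ (Im \o f) \* (Re \o g)).
    by apply: rboundedD; exact: rboundedM.
  by apply/funext => y /=; rewrite cImM.
- split.
    by rewrite (_ : Re \o _ = Re \o f) //; apply/funext => y /=; rewrite cReJ.
  rewrite (_ : Im \o _ = \- (Im \o f)); first exact: rboundedN.
  by apply/funext => y /=; rewrite cImJ.
Qed.

Lemma PDC : P (~` D) = 0%E.
Proof. by rewrite probability_setC // PD subee. Qed.

Lemma ae_of_full (Q : T -> Prop) : (forall x, D x -> Q x) -> {ae P, forall x, Q x}.
Proof.
move=> DQ; exists (~` D); split; [exact: measurableC|exact: PDC|].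
by move=> x /= nQ Dx; apply/nQ/DQ.
Qed.

Lemma rbounded_integrable f : rbounded f -> P.-integrable setT (EFin \o f).
Proof.
move=> [mf [K Kf]].
apply/(negligible_integrable (N := ~` D)) => //.
- exact: measurableC.
- exact/measurable_EFinP.
- exact: PDC.
rewrite setTD setCK; apply: measurable_bounded_integrable => //.
- exact: le_lt_trans (probability_le1 P mD) (ltry _).
- exact: measurable_funTS.
- exists K; split; first exact: num_real.
  by move=> L KL x Dx; apply: le_trans (Kf x Dx) (ltW KL).
Qed.

Lemma rbounded_Rintegral_eq f g : rbounded f -> rbounded g ->
  (forall x, D x -> f x = g x) -> \int[P]_x f x = \int[P]_x g x.
Proof.
move=> [mf _] [mg _] fg; rewrite /Rintegral; congr fine.
apply: ae_eq_integral => //; [exact/measurable_EFinP|exact/measurable_EFinP|].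
by apply: ae_of_full => x Dx _; rewrite fg.
Qed.

Lemma cexpectation_eq f g : cbounded f -> cbounded g ->
  (forall x, D x -> f x = g x) -> E f = E g.
Proof.
move=> [fr fi] [gr gi] fg; apply: complex_ext => /=.
  by apply: (rbounded_Rintegral_eq fr gr) => x Dx /=; rewrite fg.
by apply: (rbounded_Rintegral_eq fi gi) => x Dx /=; rewrite fg.
Qed.

Lemma cexpectationD f g : cbounded f -> cbounded g ->
  E (fun x => f x + g x) = E f + E g.
Proof.
move=> [fr fi] [gr gi]; apply: complex_ext; rewrite /= ?cReD ?cImD /=.
  under eq_Rintegral do rewrite cReD.
  by apply: RintegralD => //; [exact: (rbounded_integrable fr)|
    exact: (rbounded_integrable gr)].
under eq_Rintegral do rewrite cImD.
by apply: RintegralD => //; [exact: (rbounded_integrable fi)|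
  exact: (rbounded_integrable gi)].
Qed.

Lemma cexpectation_cst c : E (fun=> c) = c.
Proof.
have P1 : fine (P [set: T]) = 1 by rewrite probability_setT.
by apply: complex_ext => /=; rewrite Rintegral_cst // P1 mulr1.
Qed.

Lemma cexpectationZ c f : cbounded f -> E (fun x => c * f x) = c * E f.
Proof.
move=> [fr fi].
have ir := rbounded_integrable fr; have ii := rbounded_integrable fi.
have Zr a : P.-integrable setT (EFin \o (fun x => a * Re (f x))).
  exact: (rbounded_integrable (rboundedM (rbounded_cst a) fr)).
have Zi a : P.-integrable setT (EFin \o (fun x => a * Im (f x))).
  exact: (rbounded_integrable (rboundedM (rbounded_cst a) fi)).
apply: complex_ext; rewrite ?cReM ?cImM /=.
  under eq_Rintegral do rewrite cReM.
  by rewrite RintegralB // !RintegralZl.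
under eq_Rintegral do rewrite cImM.
by rewrite RintegralD // !RintegralZl.
Qed.

Lemma cexpectation_sum (I : Type) (r : seq I) (p : pred I) (f : I -> T -> C) :
  (forall i, cbounded (f i)) ->
  E (fun x => \sum_(i <- r | p i) f i x) = \sum_(i <- r | p i) E (f i).
Proof.
move=> bf; elim: r => [|i r IHr].
  rewrite big_nil -[RHS]cexpectation_cst; congr cexpectation.
  by apply/funext => x; rewrite big_nil.
rewrite big_cons -IHr; case: (boolP (p i)) => pi.
  rewrite -cexpectationD //; last exact: (star_sum cbounded_star r p bf).
  by congr cexpectation; apply/funext => x; rewrite big_cons pi.
by congr cexpectation; apply/funext => x; rewrite big_cons (negbTE pi).
Qed.

End BoundedMeasurable.

Section HaarMoments.
Variables (R : realType) (N : nat).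
Local Notation C := R[i].
Local Notation Re := (@complex.Re R).
Local Notation Im := (@complex.Im R).
Variables (G : set 'M[C]_N) (mu : probability (borel_mx R N) R).
Hypothesis muG : is_haar G mu.

Lemma measurable_open_mx (A : set 'M[R[i]^o]_N) : open A ->
  measurable (A : set (borel_mx R N)).
Proof. by move=> oA; exact: sub_sigma_algebra. Qed.

Lemma rcontinuous_measurable (f : 'M[R[i]^o]_N -> R) : continuous f ->
  measurable_fun setT (f : borel_mx R N -> R).
Proof.
move=> cf; apply: (measurability _ (RGenOpens.measurableE R)).
move=> _ [_ [a [b ->] <-]]; rewrite setTI; apply: measurable_open_mx.
by move/continuousP : cf; apply; exact: interval_open.
Qed.

Lemma mulmx_measurable (W : 'M[C]_N) : measurable_fun setT
  ((fun V => W *m V) : borel_mx R N -> borel_mx R N).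
Proof.
have borelE : @measurable _ (borel_mx R N) = <<s @open 'M[R[i]^o]_N >> by [].
apply: (measurability _ borelE).
move=> _ [A oA <-]; rewrite setTI; apply: measurable_open_mx.
by move/continuousP : (@mulmx_continuous R N W); apply.
Qed.

(** Change of variables: left invariance says that the image of [mu] under V to W V is [mu]. *)
Lemma haar_Rintegral (W : 'M[C]_N) (f : borel_mx R N -> R) : G W ->
  measurable_fun setT f ->
  mu.-integrable setT (EFin \o (fun V => f (W *m V))) ->
  \int[mu]_V f (W *m V) = \int[mu]_V f V.
Proof.
move=> GW mf intf; rewrite /Rintegral; congr fine.
have mW := mulmx_measurable W.
have mEf : measurable_fun [set: borel_mx R N] (EFin \o f) by exact/measurable_EFinP.
have := @integral_pushforward _ _ _ _ R _ mW mu setT (EFin \o f) mEf.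
rewrite preimage_setT => /(_ intf measurableT) <-.
by apply: eq_measure_integral => A mA _; exact: muG.2.
Qed.

Variable D : set (borel_mx R N).
Hypotheses (mD : measurable D) (muD : mu D = 1%E).

Lemma haar_cexpectation (W : 'M[C]_N) (f : borel_mx R N -> C) : G W ->
  cbounded D f -> cbounded D (fun V => f (W *m V)) ->
  cexpectation mu (fun V => f (W *m V)) = cexpectation mu f.
Proof.
move=> GW [fr fi] [fWr fWi]; apply: complex_ext => /=.
  apply: (haar_Rintegral (f := Re \o f) GW fr.1).
  exact: (rbounded_integrable mD muD fWr).
apply: (haar_Rintegral (f := Im \o f) GW fi.1).
exact: (rbounded_integrable mD muD fWi).
Qed.

End HaarMoments.

(** Column j has Euclidean norm 1. *)
Lemma unitary_entry_le1 (R : realType) N (V : 'M[R[i]]_N) i j :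
  mxadj V *m V = 1%:M -> `|V i j| <= 1.
Proof.
move=> /matrixP /(_ j j); rewrite !mxE eqxx => UV.
rewrite -(@expr_le1 _ 2) // sqr_normc -[leRHS]UV (bigD1 i) //= !mxE mulrC lerDl.
by apply: sumr_ge0 => k _; rewrite !mxE mulrC -sqr_normc exprn_ge0.
Qed.

Section UnitaryEntries.
Variables (R : realType) (d : measure_display) (T : measurableType d).
Variables (D : set T) (N : nat) (V : T -> 'M[R[i]]_N).
Hypothesis VU : forall x, D x -> mxadj (V x) *m V x = 1%:M.
Hypothesis mV : forall i j,
  measurable_fun setT (fun x => complex.Re (V x i j)) /\
  measurable_fun setT (fun x => complex.Im (V x i j)).

Lemma unitary_cbounded : mxstar (cbounded D) V.
Proof.
move=> i j; have [mr mi] := mV i j; split; split=> //; exists 1 => x Dx /=.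
  by rewrite -lecR; apply: le_trans (normc_ge_Re _) (unitary_entry_le1 _ _ (VU Dx)).
by rewrite -lecR; apply: le_trans (normc_ge_Im _) (unitary_entry_le1 _ _ (VU Dx)).
Qed.

End UnitaryEntries.

(** * Second moments of expectation values *)

Section StateMoments.
Variables (R : realType) (N : nat).
Local Notation C := R[i].
Variables (rho : 'M[C]_N) (d : measure_display) (T : measurableType d).
Variables (P : probability T R) (D : set T) (V : T -> 'M[C]_N).
Hypotheses (mD : measurable D) (PD : P D = 1%E).
Hypothesis bV : mxstar (cbounded D) V.
Implicit Types O : 'M[C]_N.

Definition expval (U O : 'M[C]_N) : C := \tr (U *m rho *m mxadj U *m O).

Lemma expvalD U O O' : expval U (O + O') = expval U O + expval U O'.
Proof. by rewrite /expval mulmxDr mxtraceD. Qed.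

Lemma expvalZ U c O : expval U (c *: O) = c * expval U O.
Proof. by rewrite /expval -scalemxAr mxtraceZ. Qed.

(** With O' = 1 this becomes a first moment as soon as [V] is unitary and [rho] has trace 1. *)
Definition moment2 O O' : C := cexpectation P (fun x => expval (V x) O * expval (V x) O').

Lemma expval_star (F : (T -> C) -> Prop) (W : T -> 'M[C]_N) O :
  star_closed F -> mxstar F W -> F (fun x => expval (W x) O).
Proof.
move=> FS FW; apply: star_trace => //; apply: (mxstarM FS); last exact: mxstar_cst.
by apply: (mxstarM FS); [apply: (mxstarM FS) => //; exact: mxstar_cst|exact: mxstar_adj].
Qed.

Lemma moment2_cbounded O O' : cbounded D (fun x => expval (V x) O * expval (V x) O').
Proof.
by apply: star_mul; [exact: cbounded_star|apply: expval_star bV|apply: expval_star bV];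
  exact: cbounded_star.
Qed.

Lemma moment2C O O' : moment2 O O' = moment2 O' O.
Proof. by congr cexpectation; apply/funext => x; exact: mulrC. Qed.

Lemma moment2Dl O1 O2 O' : moment2 (O1 + O2) O' = moment2 O1 O' + moment2 O2 O'.
Proof.
rewrite -(cexpectationD mD PD); [|exact: moment2_cbounded|exact: moment2_cbounded].
by congr cexpectation; apply/funext => x; rewrite expvalD mulrDl.
Qed.

Lemma moment2Zl c O O' : moment2 (c *: O) O' = c * moment2 O O'.
Proof.
rewrite -(cexpectationZ mD PD); last exact: moment2_cbounded.
by congr cexpectation; apply/funext => x; rewrite expvalZ mulrA.
Qed.

End StateMoments.

Section HaarInvariance.
Variables (R : realType) (N : nat) (G0 : set 'M[R[i]]_N).
Local Notation C := R[i].
Let G : set 'M[C]_N := mx_closure G0.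
Variable mu : probability (borel_mx R N) R.
Hypothesis muG : is_haar G mu.
Hypothesis GU : forall V, G V -> mxadj V *m V = 1%:M.
Variable rho : 'M[C]_N.
Implicit Types O W K : 'M[C]_N.

Let idV : borel_mx R N -> 'M[C]_N := fun V => V.

Lemma closure_measurable : measurable (G : set (borel_mx R N)).
Proof.
rewrite -[G]setCK; apply: measurableC; apply: measurable_open_mx.
by apply: closed_openC; exact: closed_closure.
Qed.

Lemma haar_bounded_entries : mxstar (cbounded (G : set (borel_mx R N))) idV.
Proof.
apply: unitary_cbounded => [V|i j]; first exact: GU.
have [cr ci] := @ccontinuous_entries R N i j.
by split; apply: rcontinuous_measurable.
Qed.

Local Notation m2 := (moment2 rho mu idV).
Let mG := closure_measurable.
Let bG := haar_bounded_entries.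
Let muG1 : mu (G : set (borel_mx R N)) = 1%E := muG.1.

(** Cyclicity of the trace moves a left translation of the group variable onto the observables. *)
Lemma haar_moment2_conj W O O' : G W ->
  m2 (mxadj W *m O *m W) (mxadj W *m O' *m W) = m2 O O'.
Proof.
move=> GW.
have eW V Q : expval rho (W *m V) Q = expval rho V (mxadj W *m Q *m W).
  rewrite /expval mxadjM.
  have -> : W *m V *m rho *m (mxadj V *m mxadj W) *m Q =
      W *m (V *m rho *m mxadj V *m mxadj W *m Q) by rewrite !mulmxA.
  by rewrite mxtrace_mulC !mulmxA.
have bW : mxstar (cbounded (G : set (borel_mx R N))) (fun V => W *m idV V).
  have cS := @cbounded_star R _ _ (G : set (borel_mx R N)).
  exact: mxstarM cS _ _ _ _ _ (mxstar_cst cS W) bG.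
apply: etrans (haar_cexpectation
  (f := fun V => expval rho V O * expval rho V O') muG mG muG1 GW _ _).
- by congr cexpectation; apply/funext => V; rewrite !eW.
- exact: (moment2_cbounded rho bG).
- exact: (moment2_cbounded rho bW).
Qed.

(** Writing the form in matrix units makes it a polynomial in the entries of both arguments with
    constant coefficients, which can be differentiated along a curve of observables. *)
Lemma moment2_expand O O' : m2 O O' = \sum_i \sum_j \sum_k \sum_l
  O i j * O' k l * m2 (delta_mx i j) (delta_mx k l).
Proof.
have Dl := moment2Dl rho mG muG1 bG; have Zl := moment2Zl rho mG muG1 bG.
have m20 Q : m2 0 Q = 0 by rewrite -(scale0r (0 : 'M[C]_N)) Zl mul0r.
have ml X Q : m2 X Q = \sum_i \sum_j X i j * m2 (delta_mx i j) Q.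
  rewrite {1}[X]matrix_sum_delta (big_morph (m2^~ Q) (fun x y => Dl x y Q) (m20 Q)).
  apply: eq_bigr => i _; rewrite (big_morph (m2^~ Q) (fun x y => Dl x y Q) (m20 Q)).
  by apply: eq_bigr => j _; rewrite Zl.
rewrite ml; apply: eq_bigr => i _; apply: eq_bigr => j _.
rewrite moment2C ml mulr_sumr; apply: eq_bigr => k _.
rewrite mulr_sumr; apply: eq_bigr => l _.
by rewrite mulrA [in LHS]moment2C.
Qed.

(* Differentiates at t = 0 the left invariance under [flow K t]. *)
Lemma haar_moment2_bracket K O O' : mxadj K = - K -> (forall t, G (flow K t)) ->
  m2 (K *m O - O *m K) O' + m2 O (K *m O' - O' *m K) = 0.
Proof.
move=> Kskew GK.
pose X Q t := mxadj (flow K t) *m Q *m flow K t.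
pose X' Q t := mxadj (flow K t) *m (Q *m K - K *m Q) *m flow K t.
have dX Q : mxderiv (X Q) (X' Q) by exact: flow_adj_deriv.
have X0 Q : X Q 0 = Q by rewrite /X flow0 mxadj1 mul1mx mulmx1.
have X'0 Q : X' Q 0 = Q *m K - K *m Q by rewrite /X' flow0 mxadj1 mul1mx mulmx1.
have dm : cderiv (fun t => m2 (X O t) (X O' t))
    (fun t => m2 (X' O t) (X O' t) + m2 (X O t) (X' O' t)).
  apply: (cderiv_ext (f := fun t => \sum_i \sum_j \sum_k \sum_l
       X O t i j * X O' t k l * m2 (delta_mx i j) (delta_mx k l))
    (f' := fun t => \sum_i \sum_j \sum_k \sum_l
      ((X' O t i j * X O' t k l + X O t i j * X' O' t k l)
         * m2 (delta_mx i j) (delta_mx k l)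
       + X O t i j * X O' t k l * 0))) => [t|t|].
  - by rewrite moment2_expand.
  - rewrite !moment2_expand -big_split; apply: eq_bigr => i _.
    rewrite -big_split; apply: eq_bigr => j _.
    rewrite -big_split; apply: eq_bigr => k _.
    rewrite -big_split; apply: eq_bigr => l _ /=.
    by rewrite mulr0 addr0 mulrDl.
  - do 4 (apply: cderiv_sum => ?); apply: cderivM; last exact: cderiv_cst.
    by apply: cderivM; exact: dX.
(* By Haar invariance the same function is constant; uniqueness of derivatives gives the claim at t
   = 0. *)
have dc : cderiv (fun t => m2 (X O t) (X O' t)) (fun=> 0).
  apply: cderiv_ext (cderiv_cst (m2 O O')) => // t.
  by rewrite haar_moment2_conj.
have := cderiv_unique dm dc 0; rewrite !X0 !X'0.
have mN Q Q' : m2 (- Q) Q' = - m2 Q Q'.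
  by rewrite -scaleN1r (moment2Zl rho mG muG1 bG) mulN1r.
have brN Q : Q *m K - K *m Q = - (K *m Q - Q *m K) by rewrite opprB.
rewrite !brN mN (moment2C rho mu idV O) mN (moment2C rho mu idV _ O) -opprD.
by move=> /eqP; rewrite oppr_eq0 => /eqP.
Qed.

End HaarInvariance.

(** * The dynamical group of the cycle *)

Section CycleSymmetry.
Variables (R : realType) (n : nat).
Hypothesis n_gt1 : (1 < n)%N.
Local Notation C := R[i].
Local Notation M := 'M[C]_(dimq n).
Local Notation P := (parityX R n).
Local Notation cA := (@cycA R n).
Local Notation cG := (@cycG R n).
Local Notation rho := (rho_plus n : M).
Implicit Types K L S T O : M.

Let n_gt0 : (0 < n)%N. Proof. exact: ltnW. Qed.

Lemma mxadj_on_qubit (j : 'I_n) (a : 'M[C]_2) : mxadj a = a ->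
  mxadj (on_qubit j a) = on_qubit j a.
Proof.
move=> ha; rewrite mxadj_tensq; apply: eq_tensq => k.
by case: (k == j) => //; exact: mxadj1.
Qed.

Lemma mxadj_sumX : mxadj (sumX n) = sumX n :> M.
Proof.
rewrite mxadj_sum; apply: eq_bigr => j _.
by apply: mxadj_on_qubit; exact: mxadj_pauliX.
Qed.

Lemma Z_at_comm (j k : 'I_n) : Z_at j *m Z_at k = Z_at k *m Z_at j :> M.
Proof.
rewrite !tensqM; apply: eq_tensq => i.
by case: (i == j); case: (i == k); rewrite ?mulmx1 ?mul1mx.
Qed.

Lemma mxadj_sumZZ : mxadj (sumZZ n) = sumZZ n :> M.
Proof.
rewrite mxadj_sum; apply: eq_bigr => j _; rewrite mxadjM.
by rewrite !mxadj_on_qubit ?mxadj_pauliZ // [LHS]Z_at_comm.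
Qed.

Lemma mxadj_rho : mxadj rho = rho.
Proof.
rewrite mxadj_tensq; apply: eq_tensq => j; apply/matrixP => a b.
by rewrite /mxadj mxE mxE !plusmxE fmorphV rmorph_nat.
Qed.

Definition even_sector S := P *m S = S /\ S *m P = S.

(* The factor 4 compensates for [cycG] being twice the Onsager generator G. *)
Definition casimir S T : C := \sum_(m < n)
  (4 * (\tr (S *m cA m%:Z) * \tr (T *m cA m%:Z))
   - \tr (S *m cG m%:Z) * \tr (T *m cG m%:Z)).

Definition centralZ (l : int) : M := \sum_(m < n) cA (l + 2 * m%:Z).

Let scalar_add (a b c d e f : C) :
  4 * ((a + b) * c) - (d + e) * f = 4 * (a * c) - d * f + (4 * (b * c) - e * f).
Proof. ring. Qed.

Let scalar_leibniz (x x' y y' : C) :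
  0 * (x * x) + 4 * (x' * x + x * x') + (0 * (y * y) + (-1) * (y' * y + y * y')) =
  4 * (x' * x) - y' * y + (4 * (x * x') - y * y').
Proof. ring. Qed.

Let scalar_scale (k a b c d : C) :
  4 * (k * a * b) - k * c * d = k * (4 * (a * b) - c * d).
Proof. ring. Qed.

Let scalar_casimir (a b c d e f g h x1 y1 x2 y2 : C) :
  x1 = - (a *+ 2) -> y1 = - (e *+ 4) -> x2 = - (d *+ 2) -> y2 = - (h *+ 4) ->
  4 * (x1 * b) - y1 * f + (4 * (c * x2) - g * y2) =
  - (4 * (a *+ 2 * b + c * (d *+ 2)) - (e *+ 4 * f + g * (h *+ 4))).
Proof. by move=> -> -> -> ->; ring. Qed.

Lemma casimirC S T : casimir S T = casimir T S.
Proof.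
by apply: eq_bigr => m _; apply: (congr2 (fun x y => 4 * x - y)); exact: mulrC.
Qed.

Lemma casimirDl S1 S2 T : casimir (S1 + S2) T = casimir S1 T + casimir S2 T.
Proof.
rewrite -big_split; apply: eq_bigr => m _ /=.
rewrite !mulmxDl !mxtraceD; exact: scalar_add.
Qed.

Lemma casimirZl c S T : casimir (c *: S) T = c * casimir S T.
Proof.
rewrite mulr_sumr; apply: eq_bigr => m _ /=.
rewrite -!scalemxAl !mxtraceZ; exact: scalar_scale.
Qed.

Lemma casimirDr S T1 T2 : casimir S (T1 + T2) = casimir S T1 + casimir S T2.
Proof. by rewrite casimirC casimirDl !(casimirC S). Qed.

Lemma casimirZr c S T : casimir S (c *: T) = c * casimir S T.
Proof. by rewrite casimirC casimirZl (casimirC S). Qed.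

(** Bookkeeping for both bracket lemmas: [x] and [y] are the mixed terms, where K has acted on one
    argument and L on the other, and they cancel between the two orders. *)
Lemma scalar_jacobi (a b c d x y : C) : a + x = 0 -> y + c = 0 -> b + y = 0 ->
  x + d = 0 -> a + -1 * b + (c + -1 * d) = 0.
Proof.
move=> /eqP; rewrite addr_eq0 => /eqP -> /eqP; rewrite addrC addr_eq0 => /eqP -> /eqP.
rewrite addr_eq0 => /eqP -> /eqP; rewrite addrC addr_eq0 => /eqP ->.
by ring.
Qed.

Let trMn S T k : \tr (S *m (T *+ k)) = \tr (S *m T) *+ k.
Proof. by rewrite -scaler_nat -scalemxAr mxtraceZ mulr_natl. Qed.

Let trMN S T : \tr (S *m - T) = - \tr (S *m T).
Proof. by rewrite mulmxN; exact: raddfN. Qed.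

Let trMB S T1 T2 : \tr (S *m (T1 - T2)) = \tr (S *m T1) - \tr (S *m T2).
Proof. by rewrite mulmxBr; exact: raddfB. Qed.

Lemma mxtrace_bracket K S O :
  \tr ((K *m S - S *m K) *m O) = - \tr (S *m (K *m O - O *m K)).
Proof.
have trB X Y : \tr (X - Y) = \tr X - \tr Y :> C by exact: raddfB.
rewrite mulmxBl mulmxBr !trB opprB -!mulmxA.
by rewrite (mxtrace_mulC K (S *m O)) -mulmxA.
Qed.

(* The invariance of the Casimir form is polarized so that it passes to brackets. *)
Definition symmetry K := [/\ mxadj K = - K, P *m K = K *m P,
  (forall S T, even_sector S -> even_sector T ->
     casimir (K *m S - S *m K) T + casimir S (K *m T - T *m K) = 0) &
  (forall S l, even_sector S -> \tr ((K *m S - S *m K) *m centralZ l) = 0)].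

Lemma even_bracket K S : P *m K = K *m P -> even_sector S ->
  even_sector (K *m S - S *m K).
Proof.
move=> PK [PS SP]; split.
  by rewrite mulmxBr !mulmxA PK -[K *m P *m S]mulmxA PS.
by rewrite mulmxBl -!mulmxA SP -PK !mulmxA SP.
Qed.

Lemma cycA_casimir l S T :
  casimir (cA l *m S - S *m cA l) T + casimir S (cA l *m T - T *m cA l) = 0.
Proof.
have tA Q m : \tr ((cA l *m Q - Q *m cA l) *m cA m) = - (\tr (Q *m cG (l - m)) *+ 2).
  rewrite mxtrace_bracket (_ : _ - _ = comm (cA l) (cA m)) //.
  by rewrite comm_cycAA // trMn.
have tG Q r : \tr ((cA l *m Q - Q *m cA l) *m cG r) =
    - ((\tr (Q *m cA (l - r)) - \tr (Q *m cA (l + r))) *+ 4).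
  rewrite mxtrace_bracket (_ : _ - _ = comm (cA l) (cG r)) //.
  by rewrite comm_cycAG // trMn trMB.
have aA Q : zantiperiodic n (fun m => \tr (Q *m cA m)).
  by move=> m; rewrite cycA_anti // trMN.
have aG Q : zantiperiodic n (fun m => \tr (Q *m cG m)).
  by move=> m; rewrite cycG_anti // trMN.
have oG Q r : \tr (Q *m cG (- r)) = - \tr (Q *m cG r).
  by rewrite cycG_odd // trMN.
have := casimir_invariance n_gt0 l (aA S) (aG S) (aA T) (aG T) (oG S) (oG T).
move=> /(congr1 -%R); rewrite oppr0 => H; apply: etrans H.
rewrite -[RHS]sumrN /casimir -[LHS]big_split; apply: eq_bigr => m _ /=.
exact: scalar_casimir (tA S m) (tG S m) (tA T m) (tG T m).
Qed.

(** The bracket is a sum of G with indices l - k - 2m. The reflection m to l - k - m negates the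
    index, and G is odd, so the sum equals its opposite. *)
Lemma cycA_centralZ l k S : \tr ((cA l *m S - S *m cA l) *m centralZ k) = 0.
Proof.
rewrite mxtrace_bracket (_ : _ - _ = comm (cA l) (centralZ k)) //.
rewrite comm_sumr; under eq_bigr do rewrite comm_cycAA //.
rewrite sumrMnl trMn mulmx_sumr raddf_sum /=.
set h := fun m : int => \tr (S *m cG (l - (k + 2 * m))).
have hp : zperiodic n h.
  move=> m; rewrite /h.
  have -> : l - (k + 2 * (m + n%:Z)) = l - (k + 2 * m) - n%:Z - n%:Z by lia.
  by rewrite !antiperiodicB ?opprK //; exact: cycG_anti.
have hN m : h (l - k - m) = - h m.
  rewrite /h; have -> : l - (k + 2 * (l - k - m)) = - (l - (k + 2 * m)) by lia.
  by rewrite -trMN; congr (\tr (_ *m _)); exact: cycG_odd.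
have hsum : \sum_(m < n) h m%:Z = - \sum_(m < n) h m%:Z.
  rewrite -{1}(psum_reflect (l - k) hp) -sumrN; apply: eq_bigr => m _; exact: hN.
have -> : \sum_(m < n) h m%:Z = 0 by apply/eqP; rewrite -eqNr {1}hsum opprK.
by rewrite mul0rn oppr0.
Qed.

(** [K] has to agree with a multiple of A_l only through its commutators with even states; this
    accommodates [sumZZ n]. *)
Lemma symmetry_gen K c l : mxadj K = - K -> P *m K = K *m P ->
  (forall S, even_sector S -> K *m S - S *m K = c *: (cA l *m S - S *m cA l)) ->
  symmetry K.
Proof.
move=> Kskew PK KA; split=> // [S T eS eT|S k eS]; rewrite !KA //.
  by rewrite casimirZl casimirZr -mulrDr cycA_casimir mulr0.
by rewrite -scalemxAl mxtraceZ cycA_centralZ mulr0.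
Qed.

Lemma symmetry0 : symmetry 0.
Proof.
split=> [||S T eS eT|S l eS]; rewrite ?(mul0mx, mulmx0, subr0, mxtrace0) //.
  by apply/matrixP => i j; rewrite !mxE rmorph0 oppr0.
by rewrite -(scale0r (0 : M)) casimirZl casimirZr !mul0r addr0.
Qed.

Lemma bracketD K L S : (K + L) *m S - S *m (K + L) =
  (K *m S - S *m K) + (L *m S - S *m L).
Proof. by rewrite mulmxDl mulmxDr opprD addrACA. Qed.

Lemma bracketZ c K S : (c *: K) *m S - S *m (c *: K) = c *: (K *m S - S *m K).
Proof. by rewrite -scalemxAl -scalemxAr scalerBr. Qed.

Lemma jacobi_bracket K L S : (K *m L - L *m K) *m S - S *m (K *m L - L *m K) =
  (K *m (L *m S - S *m L) - (L *m S - S *m L) *m K)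
  + (-1) *: (L *m (K *m S - S *m K) - (K *m S - S *m K) *m L).
Proof.
have -> (X Y : M) : X + (-1) *: Y = X - Y by rewrite scaleN1r.
rewrite !(mulmxBl, mulmxBr) !mulmxA.
set a := K *m L *m S; set b := L *m K *m S; set c := S *m K *m L.
set e := S *m L *m K; set f := K *m S *m L; set g := L *m S *m K.
apply/matrixP => i j; rewrite !mxE; move: (a i j) (b i j) (c i j) (e i j) (f i j) (g i j).
by move=> *; ring.
Qed.

Lemma symmetryD K L : symmetry K -> symmetry L -> symmetry (K + L).
Proof.
move=> [sK PK cK zK] [sL PL cL zL]; split=> [||S T eS eT|S l eS].
- by rewrite mxadjD sK sL opprD.
- by rewrite mulmxDl mulmxDr PK PL.
- by rewrite !bracketD casimirDl casimirDr addrACA cK // cL // addr0.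
- by rewrite bracketD mulmxDl mxtraceD zK // zL // addr0.
Qed.

Lemma symmetryZ (a : R) K : symmetry K -> symmetry (a%:C%C *: K).
Proof.
move=> [sK PK cK zK]; split=> [||S T eS eT|S l eS].
- by rewrite mxadjZ sK conjc_real scalerN.
- by rewrite -scalemxAl -scalemxAr PK.
- by rewrite !bracketZ casimirZl casimirZr -mulrDr cK // mulr0.
- by rewrite bracketZ -scalemxAl mxtraceZ zK // mulr0.
Qed.

(** By the Jacobi identity [K, L] acts as a commutator of commutators. The invariance of K is
    applied to pairs such as ([L, S], T), which are still even. *)
Lemma symmetry_bracket K L : symmetry K -> symmetry L ->
  symmetry (K *m L - L *m K).
Proof.
move=> [sK PK cK zK] [sL PL cL zL].
have eK S : even_sector S -> even_sector (K *m S - S *m K) by exact: even_bracket.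
have eL S : even_sector S -> even_sector (L *m S - S *m L) by exact: even_bracket.
split=> [||S T eS eT|S l eS].
- by rewrite mxadjB !mxadjM sK sL !(mulNmx, mulmxN) !opprK opprB.
- by rewrite mulmxBr mulmxBl !mulmxA PK PL -!mulmxA PK PL.
- rewrite !jacobi_bracket casimirDl casimirZl casimirDr casimirZr.
  exact: scalar_jacobi (cK _ _ (eL S eS) eT) (cK _ _ eS (eL T eT))
    (cL _ _ (eK S eS) eT) (cL _ _ eS (eK T eT)).
- rewrite jacobi_bracket mulmxDl mxtraceD -scalemxAl mxtraceZ.
  by rewrite (zK _ _ (eL S eS)) (zL _ _ (eK S eS)) mulr0 addr0.
Qed.

Lemma sumX_bracket S : sumX n *m S - S *m sumX n = (-1) *: (cA 0 *m S - S *m cA 0).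
Proof. by rewrite cycA0 // scaleN1r mulNmx mulmxN opprB opprK addrC. Qed.

(** The discrepancy (P - 1) [zlast] commutes with P and is killed when P meets an even [S] on either
    side. *)
Lemma sumZZ_bracket S : even_sector S ->
  sumZZ n *m S - S *m sumZZ n = cA 1 *m S - S *m cA 1.
Proof.
move=> [PS SP]; have E := cycA1 R n_gt1; have PZ := parityX_zlast R n_gt1.
have -> : cA 1 = sumZZ n + (P *m zlast R n - zlast R n).
  by rewrite -[cA 1](subrK (sumZZ n)) E addrC mulrBl mul1r.
rewrite mulmxDl mulmxDr mulmxBl mulmxBr -mulmxA [P *m (_ *m S)]mulmxA.
rewrite [P *m zlast R n]PZ -mulmxA PS subrr addr0.
by rewrite -[zlast R n * P]PZ mulmxA SP subrr addr0.
Qed.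

Lemma skew_i (H : M) : mxadj H = H -> mxadj ('i%C *: H) = - ('i%C *: H).
Proof. move=> aH; rewrite mxadjZ aH -scaleNr; congr (_ *: _).
by apply: complex_ext; rewrite /= ?oppr0. Qed.

Lemma dla_symmetry K : dla R n K -> symmetry K.
Proof.
elim=> {K} [K [->|->]||K L _ sK _ sL|a K _ sK|K L _ sK _ sL].
- apply: (@symmetry_gen _ (- 'i%C) 0); first exact: skew_i mxadj_sumX.
    by rewrite -scalemxAl -scalemxAr [P *m _]parityX_sumX.
  by move=> S _; rewrite bracketZ sumX_bracket scalerA mulrN1.
- apply: (@symmetry_gen _ 'i%C 1); first exact: skew_i mxadj_sumZZ.
    by rewrite -scalemxAl -scalemxAr [P *m _]parityX_sumZZ.
  by move=> S eS; rewrite bracketZ sumZZ_bracket.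
- exact: symmetry0.
- exact: symmetryD.
- exact: symmetryZ.
- exact: symmetry_bracket.
Qed.

Section FlowInvariance.
Variable K : M.
Hypothesis symK : symmetry K.
Variable S : M.
Hypothesis eS : even_sector S.

Let St t := flow K t *m S *m mxadj (flow K t).

Lemma flow_parity t : P *m flow K t = flow K t *m P.
Proof. by case: symK => sK PK _ _; exact: flow_comm. Qed.

Lemma mxadj_parityX : mxadj P = P.
Proof. by rewrite mxadj_tensq; apply: eq_tensq => j; exact: mxadj_pauliX. Qed.

Lemma flow_even t : even_sector (St t).
Proof.
case: eS => PS SP; have FP := flow_parity t; split.
  by rewrite /St !mulmxA FP -[flow K t *m P *m S]mulmxA PS.
rewrite /St -mulmxA; have -> : mxadj (flow K t) *m P = P *m mxadj (flow K t).
  by rewrite -[in LHS]mxadj_parityX -mxadjM FP mxadjM mxadj_parityX.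
by rewrite mulmxA -[flow K t *m S *m P]mulmxA SP.
Qed.

(** The derivative along the flow is the invariance clause of [symmetry] at the pair (St t, St t),
    which applies because the state stays even. *)
Lemma flow_casimir t : casimir (St t) (St t) = casimir S S.
Proof.
case: (symK) => sK PK cK _; have dS := flow_state_deriv S sK.
have S0 : St 0 = S by rewrite /St flow0 mxadj1 mul1mx mulmx1.
rewrite -[in RHS]S0.
have dtr Q : cderiv (fun t => \tr (St t *m Q))
    (fun t => \tr ((K *m St t - St t *m K) *m Q)).
  apply: cderiv_trace; apply: mxderiv_ext (mxderivM dS (mxderiv_cst Q)) => // x.
  by rewrite mulmx0 addr0.
apply: (cderiv_eq0 (f := fun t => casimir (St t) (St t))).
apply: (cderiv_ext (f := fun t => casimir (St t) (St t)) (f' := fun t =>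
  \sum_(m < n) (
   (0 * (\tr (St t *m cA m%:Z) * \tr (St t *m cA m%:Z)) +
    4 * (\tr ((K *m St t - St t *m K) *m cA m%:Z) * \tr (St t *m cA m%:Z)
       + \tr (St t *m cA m%:Z) * \tr ((K *m St t - St t *m K) *m cA m%:Z)))
   + (0 * (\tr (St t *m cG m%:Z) * \tr (St t *m cG m%:Z)) +
      (-1) * (\tr ((K *m St t - St t *m K) *m cG m%:Z) * \tr (St t *m cG m%:Z)
       + \tr (St t *m cG m%:Z) * \tr ((K *m St t - St t *m K) *m cG m%:Z)))))) => //.
  move=> x; apply: etrans (cK _ _ (flow_even x) (flow_even x)).
  rewrite /casimir -[RHS]big_split.
  apply: eq_bigr => m _ /=; exact: scalar_leibniz.
have dc := @cderiv_cst R.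
apply: (cderiv_ext (f := fun t => \sum_(m < n)
   (4 * (\tr (St t *m cA m%:Z) * \tr (St t *m cA m%:Z))
   + (-1) * (\tr (St t *m cG m%:Z) * \tr (St t *m cG m%:Z)))) _ (fun=> erefl)).
  by move=> x; apply: eq_bigr => m _; rewrite mulN1r.
by apply: cderiv_sum => m; apply: cderivD; apply: cderivM (dc _) (cderivM _ _).
Qed.

Lemma flow_centralZ l t : \tr (St t *m centralZ l) = \tr (S *m centralZ l).
Proof.
case: (symK) => sK PK _ zK; have dS := flow_state_deriv S sK.
have S0 : St 0 = S by rewrite /St flow0 mxadj1 mul1mx mulmx1.
rewrite -[in RHS]S0; apply: (cderiv_eq0 (f := fun t => \tr (St t *m centralZ l))).
apply: cderiv_ext (cderiv_trace (mxderivM dS (mxderiv_cst (centralZ l)))) => // x.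
by rewrite mulmx0 addr0 zK //; exact: flow_even.
Qed.

End FlowInvariance.

Definition conserved (U : M) := [/\ mxadj U *m U = 1%:M, P *m U = U *m P,
  casimir (U *m rho *m mxadj U) (U *m rho *m mxadj U) = casimir rho rho &
  forall l, \tr (U *m rho *m mxadj U *m centralZ l) = \tr (rho *m centralZ l)].

Lemma even_state (U : M) : P *m U = U *m P -> even_sector (U *m rho *m mxadj U).
Proof.
move=> PU; split.
  by rewrite !mulmxA PU -[U *m P *m rho]mulmxA parityX_rho.
rewrite -mulmxA; have -> : mxadj U *m P = P *m mxadj U.
  by rewrite -[in LHS]mxadj_parityX -mxadjM PU mxadjM mxadj_parityX.
by rewrite mulmxA -[U *m rho *m P]mulmxA rho_parityX.
Qed.

Lemma conserved1 : conserved 1%:M.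
Proof.
by split; rewrite ?mxadj1 ?mulmx1 ?mul1mx // => l; rewrite mul1mx.
Qed.

Lemma conserved_flow K t U : symmetry K -> conserved U -> conserved (flow K t *m U).
Proof.
move=> symK [UU PU cU zU]; have eU := even_state PU; case: (symK) => sK PK _ _.
have stE : flow K t *m U *m rho *m mxadj (flow K t *m U) =
    flow K t *m (U *m rho *m mxadj U) *m mxadj (flow K t).
  by rewrite mxadjM !mulmxA.
split.
- exact: unitary_mulmx (flow_unitary _ sK) UU.
- by rewrite mulmxA flow_parity // -!mulmxA PU.
- by rewrite stE flow_casimir.
- by move=> l; rewrite stE flow_centralZ.
Qed.

Lemma conserved_lie U : connected_lie_subgroup (dla R n) U -> conserved U.
Proof.
case=> s; elim: s U => [|K s IHs] U gs ->.
  by rewrite big_nil; exact: conserved1.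
rewrite big_cons -flow1; apply: conserved_flow.
  by apply: dla_symmetry; apply: gs; rewrite inE eqxx.
by apply: IHs => // L Ls; apply: gs; rewrite inE Ls orbT.
Qed.

(** Each clause is an equation between polynomials in the entries of U and their conjugates, hence
    passes to the closure. *)
Lemma conserved_dyn_group U : dyn_group R n U -> conserved U.
Proof.
move=> GU; have cS := @ccontinuous_star R 'M[C^o]_(dimq n).
have cV := @ccontinuous_entries R (dimq n).
have cst (Q : M) := mxstar_cst cS Q.
have st : mxstar (@ccontinuous R 'M[C^o]_(dimq n)) (fun V : M => V *m rho *m mxadj V).
  exact: mxstarM cS _ _ _ _ _ (mxstarM cS cV (cst rho)) (mxstar_adj cS cV).
have tr_c Q : ccontinuous (fun V : 'M[C^o]_(dimq n) => \tr ((V : M) *m rho *m mxadj V *m Q)).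
  exact: star_trace cS _ _ (mxstarM cS st (cst Q)).
have closureP := @ccontinuous_closure R (dimq n) (connected_lie_subgroup (dla R n)).
split.
- apply/matrixP => i j; apply: (closureP _ _ (mxstarM cS (mxstar_adj cS cV) cV i j)) GU.
  by move=> V /conserved_lie [-> _ _ _].
- apply/matrixP => i j; apply/eqP; rewrite -subr_eq0 -mulN1r; apply/eqP.
  apply: (closureP (fun V => (P *m V) i j + -1 * (V *m P) i j) 0) GU.
    apply: (star_add cS); first exact: mxstarM cS _ _ _ _ _ (cst P) cV i j.
    by apply: (star_mul cS); [exact: star_cst|exact: mxstarM cS _ _ _ _ _ cV (cst P) i j].
  by move=> V /conserved_lie [_ -> _ _]; rewrite mulN1r addrN.
- apply: (closureP (fun V => casimir (V *m rho *m mxadj V) (V *m rho *m mxadj V))) GU.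
    apply: (star_sum cS) => m.
    rewrite (_ : (fun _ => _) = fun V : M =>
       4 * (\tr (V *m rho *m mxadj V *m cA m%:Z) * \tr (V *m rho *m mxadj V *m cA m%:Z))
     + (-1) * (\tr (V *m rho *m mxadj V *m cG m%:Z) * \tr (V *m rho *m mxadj V *m cG m%:Z))); last first.
      by apply/funext => V; rewrite mulN1r.
    apply: (star_add cS); apply: (star_mul cS); try exact: star_cst.
      by apply: (star_mul cS); exact: tr_c.
    by apply: (star_mul cS); exact: tr_c.
  by move=> V /conserved_lie [].
- move=> l; apply: (closureP (fun V => \tr (V *m rho *m mxadj V *m centralZ l))) GU.
    exact: tr_c.
  by move=> V /conserved_lie [].
Qed.

End CycleSymmetry.

(** * Invariance of the Haar moments under all A_r and their evaluation *)

Section HaarCycle.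
Variables (R : realType) (n : nat).
Hypothesis n_gt1 : (1 < n)%N.
Local Notation C := R[i].
Local Notation M := 'M[C]_(dimq n).
Local Notation P := (parityX R n).
Local Notation cA := (@cycA R n).
Local Notation cG := (@cycG R n).
Local Notation rho := (rho_plus n : M).
Variable mu : probability (borel_mx R (dimq n)) R.
Hypothesis muG : is_haar (dyn_group R n) mu.
Implicit Types K L O X : M.

Let n_gt0 : (0 < n)%N. Proof. exact: ltnW. Qed.
Let G : set (borel_mx R (dimq n)) := dyn_group R n.
Let idV : borel_mx R (dimq n) -> M := fun V => V.

Lemma dyn_group_unitary (V : M) : dyn_group R n V -> mxadj V *m V = 1%:M.
Proof. by move/(conserved_dyn_group n_gt1) => []. Qed.

Let mG : measurable G. Proof. exact: closure_measurable. Qed.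
Let muG1 : mu G = 1%E. Proof. exact: muG.1. Qed.
Lemma dyn_group_bounded : mxstar (cbounded G) idV.
Proof. exact: haar_bounded_entries dyn_group_unitary. Qed.
Let bG := dyn_group_bounded.

Local Notation m2 := (moment2 rho mu idV).

Let m2C := moment2C rho mu idV.
Let m2Dl := moment2Dl rho mG muG1 bG.
Let m2Zl := moment2Zl rho mG muG1 bG.
Let m2Dr O X Y : m2 O (X + Y) = m2 O X + m2 O Y.
Proof. by rewrite m2C m2Dl !(m2C O). Qed.
Let m2Zr c O X : m2 O (c *: X) = c * m2 O X.
Proof. by rewrite m2C m2Zl (m2C O). Qed.
Let m2Mnl O X k : m2 (O *+ k) X = m2 O X *+ k.
Proof. by rewrite -scaler_nat m2Zl mulr_natl. Qed.
Let m2Mnr O X k : m2 O (X *+ k) = m2 O X *+ k.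
Proof. by rewrite m2C m2Mnl m2C. Qed.
Let m2Br O X Y : m2 O (X - Y) = m2 O X - m2 O Y.
Proof. by rewrite -scaleN1r m2Dr m2Zr mulN1r. Qed.
Let m2_0r O : m2 O 0 = 0.
Proof. by rewrite -(scale0r (0 : M)) m2Zr mul0r. Qed.
Let m2_sumr O (F : 'I_n -> M) : m2 O (\sum_m F m) = \sum_m m2 O (F m).
Proof. exact: (big_morph (m2 O) (m2Dr O) (m2_0r O)). Qed.

(** The evolved state remains in the even sector, where P acts as 1. *)
Lemma expval_parity V O : dyn_group R n V -> expval rho V (P *m O) = expval rho V O.
Proof.
move=> /(conserved_dyn_group n_gt1) [_ PV _ _].
by rewrite /expval mulmxA; have [_ ->] := even_state PV.
Qed.

Let cS := @cbounded_star R _ _ G.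

Let bphi O X : cbounded G (fun V => expval rho (idV V) O * expval rho (idV V) X).
Proof. exact: moment2_cbounded bG _ _. Qed.

Let m2P O X : m2 (P *m O) X = m2 O X.
Proof.
apply: (cexpectation_eq mG muG1 (bphi _ _) (bphi _ _)) => V GV.
by rewrite expval_parity.
Qed.

Definition parity_even O := P *m O = O *m P.

(** For even observables a factor P inside [K] can be pulled out of the commutator and then replaced
    by 1. *)
Definition moment_inv K := forall O O', parity_even O -> parity_even O' ->
  m2 (K *m O - O *m K) O' + m2 O (K *m O' - O' *m K) = 0.

Let even_bracketP K O : parity_even K -> parity_even O ->
  parity_even (K *m O - O *m K).
Proof.
move=> PK PO; rewrite /parity_even mulmxBr mulmxBl !mulmxA PK PO.
by rewrite -!mulmxA PK PO.
Qed.

Lemma flow_dyn_group K t : dla R n K -> dyn_group R n (flow K t).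
Proof.
move=> gK; apply: subset_closure; exists [:: t%:C%C *: K].
  by move=> L; rewrite inE => /eqP ->; exact: lie_scale.
by rewrite big_seq1.
Qed.

Lemma moment_inv_dla K : dla R n K -> moment_inv K.
Proof.
move=> gK O O' _ _; apply: (haar_moment2_bracket muG dyn_group_unitary).
  by have [] := dla_symmetry n_gt1 gK.
by move=> t; exact: flow_dyn_group.
Qed.

Lemma moment_invZ c K : moment_inv K -> moment_inv (c *: K).
Proof.
move=> iK O O' eO eO'; rewrite !bracketZ m2Zl m2Zr -mulrDr.
by rewrite (iK _ _ eO eO') mulr0.
Qed.

Let scalar_add0 (a b c d : C) : a + c = 0 -> b + d = 0 -> a + b + (c + d) = 0.
Proof. by move=> ac bd; rewrite addrACA ac bd addr0. Qed.

Lemma moment_invD K L : moment_inv K -> moment_inv L -> moment_inv (K + L).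
Proof.
move=> iK iL O O' eO eO'; rewrite !bracketD m2Dl m2Dr.
exact: scalar_add0 (iK _ _ eO eO') (iL _ _ eO eO').
Qed.

Lemma moment_inv_bracket K L : parity_even K -> parity_even L ->
  moment_inv K -> moment_inv L -> moment_inv (K *m L - L *m K).
Proof.
move=> eK eL iK iL O O' eO eO'.
rewrite !jacobi_bracket m2Dl m2Zl m2Dr m2Zr.
exact: scalar_jacobi (iK _ _ (even_bracketP eL eO) eO')
  (iK _ _ eO (even_bracketP eL eO'))
  (iL _ _ (even_bracketP eK eO) eO') (iL _ _ eO (even_bracketP eK eO')).
Qed.

(** The moment form is bilinear over C, so the real Lie algebra acts through its
    complexification. *)
Let inv_i (H : M) : dla R n ('i%C *: H) -> moment_inv H.
Proof.
move=> gH; have -> : H = (- 'i%C) *: ('i%C *: H).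
  rewrite scalerA (_ : - 'i%C * 'i%C = 1) ?scale1r //.
  by apply: complex_ext => /=; ring.
exact/moment_invZ/moment_inv_dla.
Qed.

Lemma moment_inv_cycA0 : moment_inv (cA 0).
Proof.
have iX : moment_inv (sumX n) by apply: inv_i; apply: lie_gen; left.
rewrite (cycA0 R n) -scaleN1r; exact: moment_invZ iX.
Qed.

Lemma cycA1E : cA 1 = sumZZ n + (P *m zlast R n - zlast R n).
Proof.
by rewrite -[cA 1](subrK (sumZZ n)) (cycA1 R n_gt1) addrC mulrBl mul1r.
Qed.

Let m2PB X O : m2 (P *m X - X) O = 0.
Proof. by rewrite -scaleN1r m2Dl m2Zl m2P mulN1r addrN. Qed.

Let subr_exchange (V : zmodType) (p q r t : V) : p - q - (r - t) = p - r - (q - t).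
Proof. by rewrite !opprB -!addrA; congr (_ + _); rewrite [RHS]addrCA addrC -addrA. Qed.

(** Against an even X, the commutators with A_1 and [sumZZ n] differ by (P - 1) [[zlast], X], whose
    moments all vanish. *)
Lemma moment_inv_cycA1 : moment_inv (cA 1).
Proof.
have iZ : moment_inv (sumZZ n) by apply: inv_i; apply: lie_gen; right.
have br X : parity_even X -> cA 1 *m X - X *m cA 1 = (sumZZ n *m X - X *m sumZZ n)
    + (P *m (zlast R n *m X - X *m zlast R n) - (zlast R n *m X - X *m zlast R n)).
  move=> eX; rewrite cycA1E bracketD; congr (_ + _).
  have -> : (P *m zlast R n - zlast R n) *m X = P *m (zlast R n *m X) - zlast R n *m X.
    by rewrite mulmxBl mulmxA.
  have -> : X *m (P *m zlast R n - zlast R n) = P *m (X *m zlast R n) - X *m zlast R n.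
    by rewrite mulmxBr !mulmxA eX.
  by rewrite mulmxBr; exact: subr_exchange.
move=> O O' eO eO'; rewrite (br O) // (br O') // m2Dl m2Dr m2PB addr0.
by rewrite (m2C O (P *m _ - _)) m2PB addr0; exact: iZ.
Qed.

Let even_cycA m : parity_even (cA m). Proof. exact: parityX_cycA. Qed.
Let even_cycG m : parity_even (cG m). Proof. exact: parityX_cycG. Qed.

(** [A_1, A_0] gives G_1, and commutation with G_1 climbs from A_m and A_(m+1) to A_(m+2).
    Antiperiodicity covers the remaining integers. *)
Lemma moment_inv_cycA r : moment_inv (cA r).
Proof.
have iG1 : moment_inv (cG 1).
  have -> : cG 1 = 2^-1 *: (cA 1 *m cA 0 - cA 0 *m cA 1).
    have -> : cA 1 *m cA 0 - cA 0 *m cA 1 = cG (1 - 0) *+ 2 by exact: comm_cycAA.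
    by rewrite subr0 -[cG 1 *+ 2]scaler_nat scalerA mulVf ?scale1r // pnatr_eq0.
  apply: moment_invZ.
  exact: moment_inv_bracket (even_cycA 1) (even_cycA 0) moment_inv_cycA1 moment_inv_cycA0.
have step (m : nat) : moment_inv (cA m%:Z) /\ moment_inv (cA m.+1%:Z).
  elim: m => [|m [im im1]]; first by split; [exact: moment_inv_cycA0|exact: moment_inv_cycA1].
  split; first exact: im1.
  have E : cA m.+1%:Z *m cG 1 - cG 1 *m cA m.+1%:Z =
      (cA (m.+1%:Z - 1) - cA (m.+1%:Z + 1)) *+ 4 by exact: comm_cycAG.
  have -> : cA m.+2%:Z = cA m%:Z
      + (- 4^-1) *: (cA m.+1%:Z *m cG 1 - cG 1 *m cA m.+1%:Z).
    rewrite E -[(_ - _) *+ 4]scaler_nat scalerA mulNr mulVf ?pnatr_eq0 // scaleN1r opprB.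
    have -> : m.+1%:Z - 1 = m%:Z by lia.
    have -> : m.+1%:Z + 1 = m.+2%:Z by lia.
    by rewrite addrC subrK.
  apply: moment_invD im _; apply: moment_invZ.
  exact: moment_inv_bracket (even_cycA _) (even_cycG 1) im1 iG1.
apply: (antiperiodic_ind (P := fun r => moment_inv (cA r)) n_gt0) => [i _|x].
  by have [] := step i.
rewrite (cycA_anti R n_gt1) -scaleN1r; split=> [ix|iN]; first exact: moment_invZ ix.
have -> : cA x = -1 *: (-1 *: cA x) by rewrite scalerA mulrNN mulr1 scale1r.
exact: moment_invZ iN.
Qed.

Let a l m := m2 (cA l) (cA m).
Let c l m := m2 (cG l) (cG m).
Let e l := m2 (cA l) 1%:M.
Let z l := \tr (rho *m centralZ R n l).

Let Hac r l m : c (r - l) m *+ 2 + (a l (r - m) - a l (r + m)) *+ 4 = 0.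
Proof.
have := moment_inv_cycA r (even_cycA l) (even_cycG m).
have -> : cA r *m cA l - cA l *m cA r = cG (r - l) *+ 2 by exact: comm_cycAA.
have -> : cA r *m cG m - cG m *m cA r = (cA (r - m) - cA (r + m)) *+ 4.
  exact: comm_cycAG.
by rewrite m2Mnl m2Mnr m2Br.
Qed.

(** Invariance under A_r at the pair (G_m, 1); the identity has zero bracket. *)
Let He r m : e (r - m) = e (r + m).
Proof.
have even1 : parity_even 1%:M by rewrite /parity_even mulmx1 mul1mx.
have := moment_inv_cycA r (even_cycG m) even1.
have -> : cA r *m cG m - cG m *m cA r = (cA (r - m) - cA (r + m)) *+ 4.
  exact: comm_cycAG.
have -> : cA r *m 1%:M - 1%:M *m cA r = 0 by rewrite mulmx1 mul1mx subrr.
rewrite m2_0r addr0 m2Mnl (m2C _ 1%:M) m2Br.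
rewrite -mulr_natr => /eqP; rewrite mulf_eq0 pnatr_eq0 orbF subr_eq0 => /eqP.
by rewrite (m2C 1%:M (cA (r - m))) (m2C 1%:M (cA (r + m))).
Qed.

Let expval1 V : G V -> expval rho V 1%:M = 1.
Proof.
move=> GV; rewrite /expval mulmx1 -mulmxA mxtrace_mulC -mulmxA.
by rewrite dyn_group_unitary // mulmx1 mxtrace_rho.
Qed.

Let expvalZl V l : G V -> expval rho V (centralZ R n l) = z l.
Proof. by move/(conserved_dyn_group n_gt1) => [_ _ _]; apply. Qed.

(** The value of Z_l is the same at every group element, so it leaves the expectation as a
    constant. *)
Let m2Zc O l : m2 O (centralZ R n l) = z l * m2 O 1%:M.
Proof.
rewrite -(cexpectationZ mG muG1) //.
apply: (cexpectation_eq mG muG1 (bphi _ _)) => [|V GV].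
  by apply: (star_mul cS); [exact: star_cst cS _|].
by rewrite expvalZl // expval1 // mulr1 mulrC.
Qed.

Let m211 : m2 1%:M 1%:M = 1.
Proof.
rewrite -[RHS](cexpectation_cst mu); apply: (cexpectation_eq mG muG1) => //.
  exact: star_cst cS _.
by move=> V GV; rewrite expval1 // mulr1.
Qed.

Let Hz l : \sum_(m < n) e (l + 2 * m%:Z) = z l.
Proof.
under eq_bigr do rewrite /e m2C.
by rewrite -m2_sumr m2Zc m211 mulr1.
Qed.

Let Haz l : \sum_(m < n) a l (l + 2 * m%:Z) = z l * e l.
Proof. by rewrite -m2_sumr m2Zc. Qed.

Let rho_anti : zantiperiodic n (fun m => \tr (rho *m cA m)).
Proof. by move=> m; rewrite cycA_anti // mulmxN; exact: raddfN. Qed.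

(** Only A_0, of value -n, contributes at the initial state. *)
Let casimir_rho : casimir rho rho = 4 * n%:R ^+ 2.
Proof.
rewrite /casimir (eq_bigr (fun m : 'I_n => 4 * (\tr (rho *m cA m%:Z)) ^+ 2)).
  rewrite -mulr_sumr; congr (_ * _).
  have -> : \sum_(m < n) \tr (rho *m cA m%:Z) ^+ 2 =
      \sum_(m < n) (if m == 0%N :> nat then n%:R ^+ 2 else 0).
    apply: eq_bigr => m _; case: eqP => [->|/eqP m0]; first by rewrite rho_cycA0 // sqrrN.
    by rewrite rho_cycA_small ?expr0n // lt0n m0 ltn_ord.
  by rewrite -big_mkcond (big_pred1 (Ordinal n_gt0)).
by move=> m _; rewrite rho_cycG // mul0r subr0 expr2.
Qed.

(** Integration of the Casimir value, constant on the group. *)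
Let Hcas : 4 * \sum_(m < n) a m m - \sum_(m < n) c m m = 4 * n%:R ^+ 2.
Proof.
rewrite -casimir_rho -[RHS](cexpectation_cst mu).
have bA m : cbounded G (fun V => 4 * (expval rho (idV V) (cA m) * expval rho (idV V) (cA m))).
  by apply: (star_mul cS); [exact: star_cst cS _|].
have bGm m : cbounded G (fun V => -1 * (expval rho (idV V) (cG m) * expval rho (idV V) (cG m))).
  by apply: (star_mul cS); [exact: star_cst cS _|].
transitivity (cexpectation mu (fun V => \sum_(m < n)
  (4 * (expval rho (idV V) (cA m%:Z) * expval rho (idV V) (cA m%:Z))
   + -1 * (expval rho (idV V) (cG m%:Z) * expval rho (idV V) (cG m%:Z))))).
  rewrite (cexpectation_sum mG muG1); last first.
    by move=> m; exact: (star_add cS).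
  rewrite mulr_sumr -sumrB; apply: eq_bigr => m _.
  rewrite (cexpectationD mG muG1) // !(cexpectationZ mG muG1) //.
  by rewrite mulN1r.
apply: (cexpectation_eq mG muG1).
- by apply: (star_sum cS) => m; exact: (star_add cS).
- exact: star_cst cS _.
move=> V /(conserved_dyn_group n_gt1) [_ _ <- _].
by apply: eq_bigr => m _; rewrite mulN1r.
Qed.

Let zE l : z l = \sum_(m < n) \tr (rho *m cA (l + 2 * m%:Z)).
Proof. by rewrite /z /centralZ mulmx_sumr; exact: raddf_sum. Qed.

Lemma cycle_moments : m2 (cA 1) 1%:M = (odd n)%:R /\
  m2 (cA 1) (cA 1) = (2 * n + odd n)%:R / 3.
Proof.
have f0 := rho_cycA0 R n_gt1; have fs := rho_cycA_small R n_gt1.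
apply: (onsager_moments n_gt0 Hac He Hz Haz Hcas).
  by rewrite zE; exact: (@spin_sum1 _ n n_gt0 (fun m => \tr (rho *m cA m)) rho_anti f0 fs).
by move=> l; rewrite zE; exact: (@spin_sum_sqr _ n n_gt0 (fun m => \tr (rho *m cA m)) rho_anti f0 fs l).
Qed.

Let m2ZZ O : m2 (sumZZ n) O = m2 (cA 1) O.
Proof. by rewrite cycA1E m2Dl m2PB addr0. Qed.

Lemma sumZZ_moments : m2 (sumZZ n) 1%:M = (odd n)%:R /\
  m2 (sumZZ n) (sumZZ n) = (2 * n + odd n)%:R / 3.
Proof. by rewrite !m2ZZ (m2C (cA 1) (sumZZ n)) m2ZZ; exact: cycle_moments. Qed.

End HaarCycle.

(** * From the design to the Haar measure *)

Section MomentTransfer.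
Variables (R : realType) (N : nat) (rho : 'M[R[i]]_N).
Local Notation C := R[i].
Variables (d1 d2 : measure_display) (T1 : measurableType d1) (T2 : measurableType d2).
Variables (P1 : probability T1 R) (P2 : probability T2 R).
Variables (D1 : set T1) (D2 : set T2).
Hypotheses (mD1 : measurable D1) (PD1 : P1 D1 = 1%E).
Hypotheses (mD2 : measurable D2) (PD2 : P2 D2 = 1%E).
Variables (V1 : T1 -> 'M[C]_N) (V2 : T2 -> 'M[C]_N).
Hypotheses (bV1 : mxstar (cbounded D1) V1) (bV2 : mxstar (cbounded D2) V2).
Hypothesis eq2 : forall i j,
  cexpectation P1 (fun x => moment_op 2 (V1 x) i j) =
  cexpectation P2 (fun x => moment_op 2 (V2 x) i j).

Let cS1 := @cbounded_star R _ _ D1.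
Let cS2 := @cbounded_star R _ _ D2.

(** The functions to which the design property extends; boundedness is carried along to justify
    linearity of both expectations. *)
Let good (q : 'M[C]_N -> C) := [/\ cbounded D1 (fun x => q (V1 x)),
  cbounded D2 (fun x => q (V2 x)) &
  cexpectation P1 (fun x => q (V1 x)) = cexpectation P2 (fun x => q (V2 x))].

Let good_sum (I : finType) (q : I -> 'M[C]_N -> C) :
  (forall i, good (q i)) -> good (fun U => \sum_i q i U).
Proof.
move=> gq; have b1 i : cbounded D1 (fun x => q i (V1 x)) by have [] := gq i.
have b2 i : cbounded D2 (fun x => q i (V2 x)) by have [] := gq i.
split; first by apply: (star_sum cS1) => i; exact: b1.
  by apply: (star_sum cS2) => i; exact: b2.
rewrite (cexpectation_sum mD1 PD1) //.
rewrite (cexpectation_sum mD2 PD2) //.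
by apply: eq_bigr => i _; have [] := gq i.
Qed.

Let good_suml (I : finType) (q : I -> 'M[C]_N -> C) r :
  (forall i, good (fun U => q i U * r U)) -> good (fun U => (\sum_i q i U) * r U).
Proof.
move=> /good_sum; congr good; apply/funext => U; by rewrite mulr_suml.
Qed.

Let good_sumr (I : finType) (q : I -> 'M[C]_N -> C) r :
  (forall i, good (fun U => r U * q i U)) -> good (fun U => r U * (\sum_i q i U)).
Proof.
move=> /good_sum; congr good; apply/funext => U; by rewrite mulr_sumr.
Qed.

(** A monomial of degree two in U and two in its conjugate is an entry of [moment_op 2 U]: rows are
    indexed by (a, a') and (e, e'), columns by (b, b') and (f, f'). *)
Let good_monomial (c : C) a b a' b' e f e' f' :
  good (fun U => c * (U a b * U a' b' * (conjc (U e f) * conjc (U e' f')))).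
Proof.
have mE (U : 'M[C]_N) : U a b * U a' b' * (conjc (U e f) * conjc (U e' f')) =
    moment_op 2 U (mxtens_index (mxtens_index (a, a'), mxtens_index (e, e')))
                  (mxtens_index (mxtens_index (b, b'), mxtens_index (f, f'))).
  rewrite /moment_op tensmxE; congr (_ * _).
    by rewrite (_ : ntensmx U 2 = tensmx U U) // tensmxE.
  by rewrite (_ : ntensmx (mxconj U) 2 = tensmx (mxconj U) (mxconj U)) // tensmxE !mxE.
have b1 : cbounded D1 (fun x => V1 x a b * V1 x a' b' * (conjc (V1 x e f) * conjc (V1 x e' f'))).
  by apply: (star_mul cS1); apply: (star_mul cS1); try exact: bV1;
    apply: (star_conj cS1); exact: bV1.
have b2 : cbounded D2 (fun x => V2 x a b * V2 x a' b' * (conjc (V2 x e f) * conjc (V2 x e' f'))).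
  by apply: (star_mul cS2); apply: (star_mul cS2); try exact: bV2;
    apply: (star_conj cS2); exact: bV2.
split.
- by apply: (star_mul cS1) b1; exact: (star_cst cS1).
- by apply: (star_mul cS2) b2; exact: (star_cst cS2).
rewrite (cexpectationZ mD1 PD1) // (cexpectationZ mD2 PD2) //; congr (_ * _).
under [in LHS]eq_fun do rewrite mE; under [in RHS]eq_fun do rewrite mE.
exact: eq2.
Qed.

Let expvalE U O : expval rho U O = \sum_a \sum_e \sum_f \sum_b
  (rho b f * O e a) * (U a b * conjc (U e f)).
Proof.
rewrite /expval; apply: eq_bigr => a _; rewrite mxE; apply: eq_bigr => e _.
rewrite mxE mulr_suml; apply: eq_bigr => f _; rewrite mxE !mulr_suml.
by apply: eq_bigr => b _; rewrite !mxE; ring.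
Qed.

Let regroup (k k' x y x' y' : C) :
  k * k' * (x * x' * (y * y')) = k * (x * y) * (k' * (x' * y')).
Proof. ring. Qed.

Lemma moment2_transfer O O' : moment2 rho P1 V1 O O' = moment2 rho P2 V2 O O'.
Proof.
suff [_ _ //] : good (fun U => expval rho U O * expval rho U O').
under [X in good X]eq_fun do rewrite !expvalE.
do 4 (apply: good_suml => ?); do 4 (apply: good_sumr => ?).
apply: (eq_ind _ good (good_monomial _ _ _ _ _ _ _ _ _)).
by apply/funext => U; exact: regroup.
Qed.

End MomentTransfer.

(** * Unitarity and measurability of the random circuit *)

Section CircuitMeasurability.
Variables (R : realType) (n : nat).
Local Notation C := R[i].
Local Notation M := 'M[C]_(dimq n).
Variables (p : nat) (d : measure_display) (Omega : measurableType d).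
Variables (P : probability Omega R) (beta gamma : 'I_p -> {RV P >-> R}).

Lemma flow_entry_continuous (K : M) i j :
  continuous (fun t : R => complex.Re (flow K t i j)) /\
  continuous (fun t : R => complex.Im (flow K t i j)).
Proof.
by split=> t; have [dr di] := mxderiv_flow K i j t;
  apply: differentiable_continuous; apply/derivable1_diffP; exact: ex_derive.
Qed.

Let U (w : Omega) : M := circuit n (fun l => beta l w) (fun l => gamma l w).
Let KX : M := - 'i%C *: sumX n.
Let KZ : M := - 'i%C *: sumZZ n.

Let skewN (H : M) : mxadj H = H -> mxadj (- 'i%C *: H) = - (- 'i%C *: H).
Proof.
move=> aH; rewrite mxadjZ aH -scaleNr; congr (_ *: _).
by apply: complex_ext; rewrite /= ?oppr0.
Qed.

Let KX_skew : mxadj KX = - KX. Proof. exact: skewN (mxadj_sumX _ _). Qed.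
Let KZ_skew : mxadj KZ = - KZ. Proof. exact: skewN (mxadj_sumZZ _ _). Qed.

Let circuitE w : U w = \prod_(l < p) (flow KX (beta l w) *m flow KZ (gamma l w)).
Proof.
have scal (t : R) (H : M) : - ('i%C * t%:C%C) *: H = t%:C%C *: (- 'i%C *: H).
  by rewrite scalerA mulrN mulrC.
by apply: eq_bigr => l _; apply: (congr2 mulmx); apply: congr1; exact: scal.
Qed.

Lemma circuit_unitary w : mxadj (U w) *m U w = 1%:M.
Proof.
rewrite circuitE; apply: (big_ind (fun V : M => mxadj V *m V = 1%:M)).
- by rewrite mxadj1 mul1mx.
- exact: unitary_mulmx.
- move=> l _; exact: unitary_mulmx (flow_unitary _ KX_skew) (flow_unitary _ KZ_skew).
Qed.

Let cS := @cbounded_star R _ _ [set: Omega].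

Let flow_bounded (K : M) (X : {RV P >-> R}) : mxadj K = - K ->
  mxstar (cbounded [set: Omega]) (fun w => flow K (X w)).
Proof.
move=> Kskew; apply: unitary_cbounded => [w _|i j]; first exact: flow_unitary.
have [cr ci] := flow_entry_continuous K i j; split.
  exact: (measurableT_comp (continuous_measurable_fun cr) (measurable_funP X)).
exact: (measurableT_comp (continuous_measurable_fun ci) (measurable_funP X)).
Qed.

Lemma circuit_bounded : mxstar (cbounded [set: Omega]) U.
Proof.
rewrite (_ : U = fun w => \prod_(l < p) (flow KX (beta l w) *m flow KZ (gamma l w))); last first.
  by apply/funext => w; exact: circuitE.
elim: (index_enum _) => [|l r IHr].
  rewrite (_ : (fun _ => _) = fun=> 1); first exact: (mxstar_cst cS (1 : M)).
  by apply/funext => w; rewrite big_nil.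
rewrite (_ : (fun _ => _) = fun w => (flow KX (beta l w) *m flow KZ (gamma l w)) *m
   \prod_(l <- r) (flow KX (beta l w) *m flow KZ (gamma l w))); last first.
  by apply/funext => w; rewrite big_cons.
apply: (mxstarM cS) => //.
by apply: (mxstarM cS); apply: flow_bounded; [exact: KX_skew|exact: KZ_skew].
Qed.

End CircuitMeasurability.

Lemma expval_real (R : realType) N (rho U O : 'M[R[i]]_N) :
  mxadj rho = rho -> mxadj O = O -> complex.Im (expval rho U O) = 0.
Proof.
move=> ar aO; have : conjc (expval rho U O) = expval rho U O.
  have -> : conjc (expval rho U O) = \tr (mxadj (U *m rho *m mxadj U *m O)).
    rewrite /expval /mxtrace rmorph_sum; apply: eq_bigr => i _.
    by rewrite [in RHS]mxE [in RHS]mxE.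
  by rewrite !mxadjM mxadjK ar aO mxtrace_mulC !mulmxA.
move=> /(congr1 (@complex.Im R)); rewrite cImJ => /eqP.
by rewrite eqNr => /eqP.
Qed.

Theorem theorem5 (R : realType) (n : nat) (hn : (3 <= n)%N)
    (p : nat) (d : measure_display) (Omega : measurableType d)
    (P : probability Omega R) (beta gamma : 'I_p -> {RV P >-> R})
    (mu : probability (borel_mx R (dimq n)) R)
    (hmu : is_haar (dyn_group R n) mu)
    (hdesign : unitary_design 2 mu P
       (fun w => circuit n (fun l => beta l w) (fun l => gamma l w))) :
  let ell := fun w => loss (rho_plus n) (obs n)
               (circuit n (fun l => beta l w) (fun l => gamma l w)) in
  'E_P[ell]%E = ((odd n)%:R / Num.sqrt n%:R)%:E /\
  'V_P[ell]%E = (2 * (n%:R - (odd n)%:R) / (3 * n%:R))%:E.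
Proof.
have n1 : (1 < n)%N by apply: leq_trans hn.
move=> ell; pose U w : 'M[R[i]]_(dimq n) :=
  circuit n (fun l => beta l w) (fun l => gamma l w).
pose rho : 'M[R[i]]_(dimq n) := rho_plus n.
have bU : mxstar (cbounded [set: Omega]) U by exact: circuit_bounded.
have PT : P [set: Omega] = 1%E by exact: probability_setT.
have mT : measurable [set: Omega] by exact: measurableT.
have transfer (O O' : 'M[R[i]]_(dimq n)) := moment2_transfer rho mT PT (closure_measurable _) hmu.1 bU
  (dyn_group_bounded R n1) (hdesign 2%N isT) O O'.
have [E1 E2] := sumZZ_moments n1 hmu.
pose s : R := (Num.sqrt n%:R)^-1.
have s2 : s ^+ 2 = n%:R^-1 by rewrite exprVn sqr_sqrtr.
have bphi O O' := moment2_cbounded rho bU O O'.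
have Zl := moment2Zl rho mT PT bU.
have C2 := moment2C rho P U.
have aobs : mxadj (obs n) = obs n :> 'M[R[i]]_(dimq n).
  by rewrite mxadjZ conjc_real mxadj_sumZZ.
have im0 w : complex.Im (expval rho (U w) (obs n)) = 0.
  by apply: expval_real => //; exact: mxadj_rho.
(* The factor 1, written as the value of the identity, gives the loss degree two in U and in its
   conjugate, so that the mean too is transferred by [moment2_transfer]. *)
have ell1 w : ell w = complex.Re (expval rho (U w) (obs n) * expval rho (U w) 1%:M).
  rewrite [expval _ _ 1%:M](_ : _ = 1) ?mulr1 //.
  rewrite /expval mulmx1 -mulmxA mxtrace_mulC -mulmxA.
  by rewrite circuit_unitary mulmx1 mxtrace_rho.
(* The square of the real part is the real part of the square because the expectation value of a
   Hermitian observable is real. *)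
have ell2 w : ell w * ell w = complex.Re (expval rho (U w) (obs n) * expval rho (U w) (obs n)).
  by rewrite cReM im0 mul0r subr0.
have [b1 _] := bphi (obs n) 1%:M; have [b2 _] := bphi (obs n) (obs n).
have int1 : P.-integrable setT (EFin \o ell).
  by rewrite (funext ell1); have := rbounded_integrable mT PT b1.
have int2 : P.-integrable setT (EFin \o (ell \* ell)).
  by rewrite (funext ell2 : ell \* ell = _); have := rbounded_integrable mT PT b2.
have exp1 : 'E_P[ell]%E = ((odd n)%:R / Num.sqrt n%:R)%:E.
  have -> : 'E_P[ell]%E = (\int[P]_w ell w)%:E.
    by rewrite unlock fineK //; exact: integrable_fin_num.
  congr (_%:E); transitivity (complex.Re (moment2 rho P U (obs n) 1%:M)).
    by rewrite /moment2 /=; congr Rintegral; apply/funext.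
  by rewrite Zl transfer E1 cReZ -(rmorph_nat (@real_complex R)) mulrC.
have exp2 : 'E_P[ell \* ell]%E = ((2 * n + odd n)%:R / (3 * n%:R))%:E.
  have -> : 'E_P[ell \* ell]%E = (\int[P]_w (ell w * ell w))%:E.
    by rewrite unlock fineK //; exact: integrable_fin_num.
  congr (_%:E); transitivity (complex.Re (moment2 rho P U (obs n) (obs n))).
    by rewrite /moment2 /=; congr Rintegral; apply/funext.
  rewrite Zl C2 Zl transfer E2 mulrA -rmorphM -expr2 s2 cReZ.
  rewrite -(rmorph_nat (@real_complex R) 3) -(rmorph_nat (@real_complex R)) -fmorphV.
  by rewrite -rmorphM /= invfM mulrC -mulrA.
split=> //; rewrite /variance covarianceE.
(* It remains to compute (2n + odd(n)) / (3n) - odd(n) / n, using that odd(n) is 0 or 1 and hence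
   equals its square. *)
- rewrite exp2 exp1 -EFinM -EFinB; congr (_%:E).
  rewrite -expr2 expr_div_n sqr_sqrtr //.
  have oo : (odd n)%:R ^+ 2 = (odd n)%:R :> R by case: (odd n); rewrite ?expr1n ?expr0n.
  have n0 : n%:R != 0 :> R by rewrite pnatr_eq0; case: (n) n1.
  by rewrite oo natrD natrM; field.
- exact/Lfun1_integrable.
- exact/Lfun1_integrable.
- exact/Lfun1_integrable.
Qed.
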